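(* The generating series $$\sum_{2g-2+n>0}\frac{y^nz^{2-2g}}{n!}\,\chi(\overline{\mathcal M}_{g,n})-\widetilde V_0(y,z)$$ (sum over $g,n\ge0$) is the logarithm of the tau-function $Z^{1D}$ of the KP hierarchy (the partition function of topological 1D gravity, in the KP time variables $T_1,T_2,\dots$) evaluated at the times $$T_n=\frac1{n!}\widetilde V_n(y,z),\qquad n\ge1,$$ where $$\begin{aligned}\widetilde V_0(y,z)&:=-\frac12y^2z^2+\sum_{g\ge2}\chi(\mathcal M_{g,0})z^{2-2g},\\ \widetilde V_1(y,z)&:=yz+\sum_{g\ge1}\chi(\mathcal M_{g,1})z^{1-2g},\\ \widetilde V_2(y,z)&:=\sum_{g\ge1}\chi(\mathcal M_{g,2})z^{-2g},\\ \widetilde V_n(y,z)&:=\sum_{g\ge0}\chi(\mathcal M_{g,n})z^{2-2g-n}\quad(n\ge3).\end{aligned}$$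
   Context: The partition function of topological 1D gravity is the formal Gaussian integral $$Z^{1D}:=\frac1{\sqrt{2\pi}}\int dx\,\exp\Big(-\frac12x^2+\sum_{n\ge1}t_{n-1}\frac{x^n}{n!}\Big),$$ i.e. the exponential of the sum is expanded and integrated term by term using $\frac1{\sqrt{2\pi}}\int e^{-x^2/2}x^{m}dx=(m-1)!!$ for even $m$ and $0$ for odd $m$. Its KP time variables are $T_n=t_{n-1}/n!$ ($n\ge1$); it is a known theorem of Nishigaki–Yoneya that $Z^{1D}$ is a tau-function of the KP hierarchy with respect to $(T_1,T_2,\dots)$. $\chi(\mathcal M_{g,n})=(-1)^n\frac{(2g-1)B_{2g}}{(2g)!}(2g+n-3)!$ for $2g-2+n>0$ is the orbifold Euler characteristic of $\mathcal M_{g,n}$ (Harer–Zagier formula), and $\chi(\overline{\mathcal M}_{g,n})$ is that of the Deligne–Mumford moduli space; by Bini–Harer, $\chi(\overline{\mathcal M}_{g,n})=n!\sum_{\Gamma}\frac1{|\mathrm{Aut}(\Gamma)|}\prod_v\chi(\mathcal M_{g_v,\mathrm{val}_v})$, the sum being over isomorphism classes of connected stable graphs of genus $g$ with $n$ unlabelled external edges (vertices $v$ have genus $g_v$ and valence $\mathrm{val}_v$ with $2g_v-2+\mathrm{val}_v>0$; the genus of $\Gamma$ is $h^1(\Gamma)+\sum_vg_v$; automorphisms act on vertices and half-edges and may permute external edges). Here $y,z$ are formal variables and the identity is one of formal series in $y$, $z^{\pm1}$, coefficient by coefficient. *)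

(* Defs.v *)
From mathcomp Require Import all_boot all_order all_fingroup all_algebra.
From mathcomp Require Import all_classical.

Set Implicit Arguments.
Unset Strict Implicit.
Unset Printing Implicit Defensive.

Import Order.TTheory GRing.Theory Num.Theory.

Local Open Scope ring_scope.

(** * Orbifold Euler characteristics of M_{g,n} *)

(* B_0 = 1 and \sum_(k <= n) 'C(n+1, k) B_k = 0 for n > 0 *)
Fixpoint bernoullis (n : nat) : seq rat :=
  if n is n'.+1 then
    let s := bernoullis n' in
    rcons s (if n' == 0%N then 1
             else - (\sum_(k < n') 'C(n'.+1, k)%:R * s`_k) / n'.+1%:R)
  else [::].

Definition bernoulli (n : nat) : rat := (bernoullis n.+1)`_n.

(* The Harer-Zagier formula; only meaningful when 2g - 2 + n > 0, in which case
   the natural number subtraction below is not truncated. *)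
Definition chiM (g n : nat) : rat :=
  (-1) ^+ n * (((2 * g)%:R - 1) * bernoulli (2 * g)%N / ((2 * g)%N)`!%:R)
  * ((2 * g + n - 3)%N)`!%:R.

(** * Stable graphs *)

(* A graph with vertex set V and set of half-edges H, whose vertices carry
   genera at most g: the genus labelling, the vertex at which each half-edge is
   attached, and the gluing of the half-edges. When the gluing is an involution,
   its two-element orbits are the internal edges and its fixed points are the
   external edges. *)
Definition graph (g : nat) (V H : finType) : Type :=
  ({ffun V -> 'I_g.+1} * {ffun H -> V} * {ffun H -> H})%type.

Section Graph.
Local Open Scope nat_scope.
Variables (g : nat) (V H : finType).
Implicit Types (G : graph g V H) (p : ({perm V} * {perm H})%type).

Definition vgenus G (v : V) : nat := G.1.1 v.
Definition attach G : H -> V := G.1.2.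
Definition gluing G : H -> H := G.2.

Definition val_at G (v : V) : nat := #|[set x | attach G x == v]%SET|.

Definition external G : {set H} := [set x | gluing G x == x]%SET.

Definition internal G : {set {set H}} :=
  [set [set x; gluing G x] | x in ~: external G]%SET.

Definition adjacent G : rel V :=
  fun v w => [exists x, (attach G x == v) && (attach G (gluing G x) == w)].

Definition components G : nat := n_comp (adjacent G) predT.

(* First Betti number #edges - #vertices + #components; when the gluing is an
   involution this is nonnegative and the subtraction is not truncated. *)
Definition betti1 G : nat := #|internal G| + components G - #|V|.

Definition genus G : nat := betti1 G + \sum_v vgenus G v.

Definition connected_stable (n : nat) G : bool :=
  [&& [forall x, gluing G (gluing G x) == x],
      components G == 1,
      [forall v, 2 < 2 * vgenus G v + val_at G v],
      genus G == g
    & #|external G| == n].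

Definition is_iso p G G' : bool :=
  [&& [forall v, vgenus G' (p.1 v) == vgenus G v],
      [forall x, attach G' (p.2 x) == p.1 (attach G x)]
    & [forall x, gluing G' (p.2 x) == p.2 (gluing G x)]].

Definition isomorphic G G' : bool := [exists p, is_iso p G G'].

Definition graph_aut G : {set ({perm V} * {perm H})%type} :=
  [set p | is_iso p G G]%SET.

Definition graph_weight G : rat :=
  ((#|graph_aut G|%:R)^-1 * \prod_v chiM (vgenus G v) (val_at G v))%R.

(* The sum over isomorphism classes, by means of a transversal. *)
Definition graph_sum (n : nat) : rat :=
  let D := [set G | connected_stable n G]%SET in
  (\sum_(G in transversal (equivalence_partition isomorphic D) D)
     graph_weight G)%R.

End Graph.

(* The Bini-Harer formula. Every finite graph is isomorphic to one with vertex
   set 'I_v and set of half-edges 'I_h for exactly one pair (v, h). Stability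
   leaves only finitely many pairs: v <= 2g - 2 + n and h <= 6g - 6 + 3n. *)
Definition chiMbar (g n : nat) : rat :=
  n`!%:R *
  \sum_(vh \in [set: (nat * nat)%type]%classic) graph_sum g 'I_vh.1 'I_vh.2 n.

(** * Formal series *)

(* A formal series with monomials in an additive group M of exponents is the
   function M -> rat of its coefficients; products and infinite sums are taken
   coefficient by coefficient. A sum over \in denotes 0 when infinitely many of
   its terms are nonzero; this does not occur for the series considered here. *)
Section Series.
Variable M : zmodType.
Implicit Types f h : M -> rat.

Definition monomial (e : M) : M -> rat := fun m => (m == e)%:R.

Definition series_sum (I : choiceType) (A : set I) (F : I -> M -> rat) :
  M -> rat := fun m => \sum_(i \in A) F i m.

Definition series_mul f h : M -> rat :=
  fun m => \sum_(e \in [set: M]%classic) f e * h (m - e).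

Definition series_pow f (k : nat) : M -> rat :=
  iter k (series_mul f) (monomial 0).

Definition series_exp f : M -> rat :=
  series_sum [set: nat]%classic (fun k => (k`!%:R)^-1 \*o series_pow f k).

Definition series_log f : M -> rat :=
  series_sum [set k : nat | (0 < k)%N]%classic
    (fun k => ((-1) ^+ k.-1 / k%:R) \*o series_pow (f \- monomial 0) k).

(** * The partition function of topological 1D gravity *)

(* The normalized Gaussian integral of x ^ m, i.e. (m - 1)!! or 0. *)
Definition gauss_moment (m : nat) : rat :=
  if odd m then 0 else (\prod_(i < m./2) (2 * i + 1)%N)%:R.

(* x ^ n times f; in an exponent in int * M the first component is that of x. *)
Definition times_xpow (n : nat) f : (int * M)%type -> rat :=
  fun e => (e.1 == n%:Z)%:R * f e.2.

End Series.

(* t n stands for t_n; the times are themselves series with exponents in M, so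
   that Z1D t is the partition function evaluated at these times. *)
Definition action1D (M : zmodType) (t : nat -> M -> rat) :
  (int * M)%type -> rat :=
  series_sum [set n : nat | (0 < n)%N]%classic
    (fun n => (n`!%:R)^-1 \*o times_xpow n (t n.-1)).

Definition Z1D (M : zmodType) (t : nat -> M -> rat) : M -> rat :=
  series_sum [set: nat]%classic
    (fun j e => gauss_moment j * series_exp (action1D t) (j%:Z, e)).

(* Z1D in the KP times T n = T_n = t_{n-1} / n!, n >= 1; T 0 is not used. *)
Definition Z1D_KP (M : zmodType) (T : nat -> M -> rat) : M -> rat :=
  Z1D (fun n => n.+1`!%:R \*o T n.+1).

(** * Series in y and z *)

(* The exponent (a, b) stands for y ^ a z ^ b. *)
Definition yz_series := (int * int)%type -> rat.

Definition yz (a b : int) : yz_series := monomial (a, b).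

Definition V_vertex (gmin n : nat) : yz_series :=
  series_sum [set g : nat | (gmin <= g)%N]%classic
    (fun g => chiM g n \*o yz 0 (2 - 2 * g%:Z - n%:Z)).

Definition Vtilde (n : nat) : yz_series :=
  match n with
  | 0 => (- 2^-1) \*o yz 2 2 \+ V_vertex 2 0
  | 1 => yz 1 1 \+ V_vertex 1 1
  | 2 => V_vertex 1 2
  | _ => V_vertex 0 n
  end.

Definition chiMbar_series : yz_series :=
  series_sum [set gn : (nat * nat)%type | (2 < 2 * gn.1 + gn.2)%N]%classic
    (fun gn => (chiMbar gn.1 gn.2 / gn.2`!%:R) \*o yz gn.2%:Z (2 - 2 * gn.1%:Z)).

(* Main.v *)
Require Import Defs.
From mathcomp Require Import all_boot all_order all_fingroup all_algebra.
From mathcomp Require Import all_classical.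
From mathcomp Require Import zify ring.

Set Implicit Arguments.
Unset Strict Implicit.
Unset Printing Implicit Defensive.

Import Order.TTheory GRing.Theory Num.Theory.

Local Open Scope ring_scope.

(** The identity is the Feynman expansion of a formal Gaussian integral, and it
holds for any weights in place of the Euler characteristics.

Put z = 1/q and y = u q^2, so that yz = U := uq. The vertex series of valence n
becomes W_n, the sum over g of chi(M_{g,n}) q^(2g-2+n), the source U joins W_1,
and every series in sight becomes a power series in q whose coefficients are
polynomials in u. Both sides are compared modulo q^(N+1), for every N, in the ring
{poly {poly rat}} (outer variable q, inner variable u): [represents] relates a
series in y and z to such a polynomial.

The Gaussian integral is expanded as follows. The coefficient of x^a in the l-th
power of the sum of W_n x^n / n! is a sum over all maps from a half-edges to l
vertices, divided by a! ([coef_prod]). The remaining factor exp(Ux) is integrated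
against x^a: up to the constant factor exp(U^2/2), the result is the sum over all
involutions of the a half-edges of U to the number of fixed points
([gauss_poly_inv]); the two-cycles of an involution are the internal edges and its
fixed points are the legs. Hence Z = exp(U^2/2) A, where A sums the weights of all
labelled graphs, each divided by l! a! ([Zpoly_eqm]).

A is the exponential of the same sum C over connected graphs. This is proved in
the form A' = C' A, the derivative being in q: by the Leibniz rule, A' marks a
vertex of a graph, and a graph with a marked vertex is the component of that
vertex, which is marked and connected, together with an arbitrary graph on the
other labels ([deriv_all_sum]). As a power series with constant term 1 has only
one logarithm, log Z = U^2/2 + C ([log_Zpoly]).

It remains to recognize C. By the orbit-stabilizer theorem, summing over labelled
graphs and dividing by l! a! is the same as summing over isomorphism classes and
dividing by the orders of the automorphism groups ([graph_sum_labelled]). By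
Euler's formula ([euler]), the exponent of q determines the genus: a graph of genus
g with k legs contributes to u^k q^(2g-2+2k), which is y^k z^(2-2g). The sum defining
chi(Mbar_{g,k}) also contains the graph with one vertex and no half-edge, which
W_n for n >= 1 does not produce; it and the term U^2/2 make up the correction
V_0. *)

(** * Cutting finite functions along a subset *)

Section Split.
Variable V : finType.

Definition splits (S : {set V}) (V1 V2 : finType) (p : V1 + V2 -> V)
    (p' : V -> V1 + V2) : Prop :=
  [/\ cancel p p', cancel p' p, forall a, p (inl a) \in S
    & forall b, p (inr b) \notin S].

(** A numbering of a subset and of its complement. Subgraphs are transported to
ordinals by such numberings, so that sums over them depend on cardinals only. *)
Lemma exists_splits (S : {set V}) :
  exists (p : 'I_#|S| + 'I_#|~: S| -> V) p', splits S p p'.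
Proof.
pose p (s : 'I_#|S| + 'I_#|~: S|) : V :=
  match s with inl a => enum_val a | inr b => enum_val b end.
have pl a : p (inl a) \in S by apply: enum_valP.
have pr b : p (inr b) \notin S by have := enum_valP b; rewrite inE.
have p_inj : injective p.
  move=> [a|b] [a'|b'] /=.
  - by move/enum_val_inj->.
  - by move=> E; have := pr b'; rewrite -[p _]E (pl a).
  - by move=> E; have := pr b; rewrite [p _]E (pl a').
  - by move/enum_val_inj->.
have p_bij : bijective p.
  apply: inj_card_bij => //.
  by rewrite card_sum !card_ord cardsC.
by case: p_bij => p' pK p'K; exists p, p'.
Qed.

End Split.

Section Join.
Variables (V1 V2 V H1 H2 H : finType).
Variables (S : {set V}) (T : {set H}).
Variables (p : V1 + V2 -> V) (p' : V -> V1 + V2).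
Variables (q : H1 + H2 -> H) (q' : H -> H1 + H2).

Definition joinf (f1 : {ffun H1 -> V1}) (f2 : {ffun H2 -> V2}) : {ffun H -> V} :=
  [ffun x => match q' x with inl h => p (inl (f1 h)) | inr h => p (inr (f2 h)) end].

Definition compat (f : {ffun H -> V}) : bool :=
  [forall x, (f x \in S) == (x \in T)].

Hypotheses (pS : splits S p p') (qT : splits T q q').

Lemma joinf_inl f1 f2 h : joinf f1 f2 (q (inl h)) = p (inl (f1 h)).
Proof. by rewrite ffunE; case: qT => -> _ _ _. Qed.

Lemma joinf_inr f1 f2 h : joinf f1 f2 (q (inr h)) = p (inr (f2 h)).
Proof. by rewrite ffunE; case: qT => -> _ _ _. Qed.

Lemma splits_ind (P : H -> Prop) :
  (forall a, P (q (inl a))) -> (forall b, P (q (inr b))) -> forall x, P x.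
Proof.
by move=> Pl Pr x; case: qT => _ q'K _ _; rewrite -[x]q'K; case: (q' x).
Qed.

Lemma splits_inj : injective p.
Proof. by case: pS => /can_inj. Qed.

Lemma compat_joinf f1 f2 : compat (joinf f1 f2).
Proof.
have [_ _ pl pr] := pS; have [_ _ ql qr] := qT.
apply/forallP; apply: splits_ind => a.
  by rewrite joinf_inl pl ql.
by rewrite joinf_inr (negbTE (pr _)) (negbTE (qr _)).
Qed.

Lemma compatE f : compat f -> exists f12, f = joinf f12.1 f12.2.
Proof.
have [pK p'K pl pr] := pS; have [qK q'K ql qr] := qT.
move=> /forallP cf.
have ex1 h : exists v, f (q (inl h)) = p (inl v).
  case E: (p' (f (q (inl h)))) => [v|v]; first by exists v; rewrite -E p'K.
  have := cf (q (inl h)).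
  by rewrite ql -[f (q (inl h))]p'K E (negbTE (pr _)).
have ex2 h : exists v, f (q (inr h)) = p (inr v).
  case E: (p' (f (q (inr h)))) => [v|v]; last by exists v; rewrite -E p'K.
  have := cf (q (inr h)).
  by rewrite (negbTE (qr _)) -[f (q (inr h))]p'K E pl.
have [f1 f1E] := fin_all_exists ex1.
have [f2 f2E] := fin_all_exists ex2.
exists (finfun f1, finfun f2); apply/ffunP; apply: splits_ind => h.
  by rewrite joinf_inl ffunE.
by rewrite joinf_inr ffunE.
Qed.

Lemma joinf_inj f1 f2 g1 g2 : joinf f1 f2 = joinf g1 g2 -> f1 = g1 /\ f2 = g2.
Proof.
move=> /ffunP E; split; apply/ffunP => h.
  by have := E (q (inl h)); rewrite !joinf_inl => /splits_inj [].
by have := E (q (inr h)); rewrite !joinf_inr => /splits_inj [].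
Qed.

(** A map that sends T to S and the complement of T to that of S is a pair of
independent maps. *)
Lemma big_compat (R : nmodType) (F : {ffun H -> V} -> R) :
  \sum_(f | compat f) F f = \sum_f1 \sum_f2 F (joinf f1 f2).
Proof.
rewrite pair_big /=.
rewrite -(big_imset (h := fun g => joinf g.1 g.2) (A := predT) F) /=; last first.
  by move=> [f1 f2] [g1 g2] _ _ /joinf_inj /= [-> ->].
apply: eq_bigl => f; apply/idP/imsetP.
  by case/compatE => g ->; exists g.
by case=> g _ ->; apply: compat_joinf.
Qed.

Lemma card_splits (P : pred H) :
  #|[set x | P x]%SET|
    = (#|[set x | P (q (inl x))]%SET| + #|[set x | P (q (inr x))]%SET|)%N.
Proof.
have [qK q'K ql qr] := qT.
rewrite -!sum1dep_card (reindex q) /=; last by exists q' => x _; [apply: qK|apply: q'K].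
by rewrite big_sumType.
Qed.

End Join.

(** * Graphs without genera, and their weights *)

Definition involb (H : finType) (s : {ffun H -> H}) : bool :=
  [forall x, s (s x) == x].

(** Together, f : H -> V (attachment of half-edges) and the involution s on H
(gluing) describe the skeleton of a graph: what remains of it without the genera of
its vertices. *)
Definition skadj (V H : finType) (f : {ffun H -> V}) (s : {ffun H -> H}) : rel V :=
  fun v w => [exists x, (f x == v) && (f (s x) == w)].

Definition skconn (V H : finType) (f : {ffun H -> V}) (s : {ffun H -> H}) : bool :=
  n_comp (skadj f s) predT == 1%N.

Definition valence (V H : finType) (f : {ffun H -> V}) (v : V) : nat :=
  #|[set x | f x == v]%SET|.

Definition legs (V H : finType) (f : {ffun H -> V}) (s : {ffun H -> H}) (v : V) : nat :=
  #|[set x | (f x == v) && (s x == x)]%SET|.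

Lemma skadj_sym (V H : finType) (f : {ffun H -> V}) (s : {ffun H -> H}) :
  involb s -> connect_sym (skadj f s).
Proof.
move=> /forallP inv; apply: sym_connect_sym.
suff sub v w : skadj f s v w -> skadj f s w v by move=> v w; apply/idP/idP; apply: sub.
case/existsP => x /andP [fv fw]; apply/existsP; exists (s x).
by rewrite fw (eqP (inv x)) fv.
Qed.

(** Reachability from a given vertex is easier to transport along joins and
relabellings than a number of components. *)
Lemma skconn_root (V H : finType) (f : {ffun H -> V}) (s : {ffun H -> H}) (v : V) :
  involb s -> skconn f s = [forall w, connect (skadj f s) v w].
Proof.
move=> inv; have sym := skadj_sym f inv.
apply/idP/forallP => [/eqP c1 w|cv].
  have rin z : fingraph.root (skadj f s) z \in predI (roots (skadj f s)) (mem predT).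
    by rewrite inE /= andbT; apply: roots_root.
  rewrite -(root_connect sym).
  have /card_le1P c : (#|predI (roots (skadj f s)) (mem predT)| <= 1)%N.
    by rewrite [X in (X <= _)%N]c1.
  by have := c _ (rin v) (fingraph.root (skadj f s) w); rewrite rin inE => /esym/eqP ->.
rewrite /skconn -(n_comp_connect sym v); apply/eqP/eq_n_comp_r => w.
by rewrite [in RHS]inE cv.
Qed.

Lemma skconn_inh (V H : finType) (f : {ffun H -> V}) (s : {ffun H -> H}) :
  skconn f s -> exists v : V, True.
Proof.
move/eqP => c1; have : (0 < #|predI (roots (skadj f s)) (mem predT)|)%N.
  by rewrite [X in (0 < X)%N]c1.
by case/card_gt0P => v _; exists v.
Qed.

Definition skcomp (V H : finType) (f : {ffun H -> V}) (s : {ffun H -> H}) (v : V) : {set V} :=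
  [set w | connect (skadj f s) v w]%SET.

Section JoinGraph.
Variables (V1 V2 V H1 H2 H : finType).
Variables (S : {set V}) (T : {set H}).
Variables (p : V1 + V2 -> V) (p' : V -> V1 + V2).
Variables (q : H1 + H2 -> H) (q' : H -> H1 + H2).
Hypotheses (pS : splits S p p') (qT : splits T q q').
Variables (f1 : {ffun H1 -> V1}) (f2 : {ffun H2 -> V2}).
Variables (s1 : {ffun H1 -> H1}) (s2 : {ffun H2 -> H2}).

Let f := joinf p q' f1 f2.
Let s := joinf q q' s1 s2.

Lemma involb_joinf : involb s = involb s1 && involb s2.
Proof.
have qinj := splits_inj qT.
apply/forallP/andP => [inv|[/forallP i1 /forallP i2]]; last first.
  apply: (splits_ind qT) => x.
    by rewrite !(joinf_inl _ qT) (eqP (i1 x)).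
  by rewrite !(joinf_inr _ qT) (eqP (i2 x)).
split; apply/forallP => x.
  by have /eqP := inv (q (inl x)); rewrite !(joinf_inl _ qT) => /qinj [->].
by have /eqP := inv (q (inr x)); rewrite !(joinf_inr _ qT) => /qinj [->].
Qed.

Lemma skadj_joinf_inl v w :
  skadj f s (p (inl v)) w -> exists2 w1, w = p (inl w1) & skadj f1 s1 v w1.
Proof.
have pinj := splits_inj pS.
case/existsP; apply: (splits_ind qT) => x; rewrite /f /s.
  rewrite !(joinf_inl _ qT) => /andP [/eqP/pinj [fv] /eqP <-].
  exists (f1 (s1 x)) => //; apply/existsP; exists x.
  by rewrite fv !eqxx.
by rewrite !(joinf_inr _ qT) => /andP [/eqP/pinj].
Qed.

(** No edge crosses from one summand of a disjoint union to the other. *)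
Lemma connect_joinf_inl v w :
  connect (skadj f s) (p (inl v)) w =
  [exists w1, (w == p (inl w1)) && connect (skadj f1 s1) v w1].
Proof.
apply/idP/existsP.
  case/connectP => r; elim: r v => [|z r IHr] v /=.
    by move=> _ ->; exists v; rewrite eqxx connect0.
  case/andP => /skadj_joinf_inl [z1 -> vz] pr /(IHr _ pr) [w1 /andP [wE zw]].
  by exists w1; rewrite wE (connect_trans (connect1 vz)).
case=> w1 /andP [/eqP -> /connectP [r pr ->]].
elim: r v pr => [|z r IHr] v /=; first by rewrite connect0.
case/andP => /existsP [x /andP [/eqP fv /eqP fz]] /IHr; apply: connect_trans.
apply/connect1/existsP; exists (q (inl x)).
by rewrite /f /s !(joinf_inl _ qT) fv fz !eqxx.
Qed.

Lemma skcomp_joinf_inl v :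
  involb s1 -> (skcomp f s (p (inl v)) == S) = skconn f1 s1.
Proof.
move=> inv1; have [_ p'K pl pr] := pS; have pinj := splits_inj pS.
rewrite (skconn_root _ v inv1); apply/eqP/forallP => [E w|c].
  have : p (inl w) \in S by [].
  rewrite -E inE connect_joinf_inl => /existsP [w1 /andP [/eqP/pinj [->]]]; exact.
apply/setP; apply: (splits_ind pS) => w.
  rewrite inE pl connect_joinf_inl; apply/existsP; exists w.
  by rewrite eqxx c.
rewrite inE (negbTE (pr w)) connect_joinf_inl; apply/existsP => -[w1].
by case/andP => /eqP/pinj.
Qed.

Lemma skcomp_joinf_inr v : (skcomp f s (p (inr v)) == S) = false.
Proof.
have [_ _ _ pr] := pS.
by apply/negP => /eqP E; have := pr v; rewrite -E inE connect0.
Qed.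

Lemma preim_joinf : (f @^-1: S = T)%SET.
Proof.
apply/setP => x; rewrite inE.
by apply/eqP; have /forallP := compat_joinf pS qT f1 f2; apply.
Qed.

Lemma valence_inl v : valence f (p (inl v)) = valence f1 v.
Proof.
have pinj := splits_inj pS.
rewrite /valence (card_splits qT) [X in (_ + X)%N]eq_card0 ?addn0; last first.
  by move=> x; rewrite !inE (joinf_inr _ qT); apply/eqP => /pinj.
by apply: eq_card => x; rewrite !inE (joinf_inl _ qT) (inj_eq pinj).
Qed.

Lemma valence_inr v : valence f (p (inr v)) = valence f2 v.
Proof.
have pinj := splits_inj pS.
rewrite /valence (card_splits qT) [X in (X + _)%N]eq_card0 ?add0n; last first.
  by move=> x; rewrite !inE (joinf_inl _ qT); apply/eqP => /pinj.
by apply: eq_card => x; rewrite !inE (joinf_inr _ qT) (inj_eq pinj).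
Qed.

Lemma legs_inl v : legs f s (p (inl v)) = legs f1 s1 v.
Proof.
have pinj := splits_inj pS; have qinj := splits_inj qT.
rewrite /legs (card_splits qT) [X in (_ + X)%N]eq_card0 ?addn0; last first.
  by move=> x; rewrite !inE (joinf_inr _ qT); apply/andP => -[/eqP/pinj].
by apply: eq_card => x; rewrite !inE !(joinf_inl _ qT) (inj_eq pinj) (inj_eq qinj).
Qed.

Lemma legs_inr v : legs f s (p (inr v)) = legs f2 s2 v.
Proof.
have pinj := splits_inj pS; have qinj := splits_inj qT.
rewrite /legs (card_splits qT) [X in (X + _)%N]eq_card0 ?add0n; last first.
  by move=> x; rewrite !inE (joinf_inl _ qT); apply/andP => -[/eqP/pinj].
by apply: eq_card => x; rewrite !inE !(joinf_inr _ qT) (inj_eq pinj) (inj_eq qinj).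
Qed.

End JoinGraph.

Section Weights.
Variables (B : comNzRingType) (phi : nat -> nat -> {poly B}).

(** The weight is a product over the vertices, each leg being charged to the
vertex that carries it, so that it is multiplicative over disjoint unions and so
that a derivation acts on one vertex at a time. *)
Definition vweight (V H : finType) (f : {ffun H -> V}) s v : {poly B} :=
  phi (valence f v) (legs f s v).

Definition weight (V H : finType) (f : {ffun H -> V}) s : {poly B} :=
  \prod_v vweight f s v.

(** The term of the Leibniz rule in which the derivative falls on the vertex v. *)
Definition weight_der (V H : finType) (f : {ffun H -> V}) s v : {poly B} :=
  (vweight f s v)^`() * \prod_(w | w != v) vweight f s w.

Lemma deriv_prod (I : finType) (F : I -> {poly B}) :
  (\prod_i F i)^`() = \sum_i (F i)^`() * \prod_(j | j != i) F j.
Proof.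
suff gen (r : seq I) : uniq r ->
    (\prod_(i <- r) F i)^`() = \sum_(i <- r) (F i)^`() * \prod_(j <- r | j != i) F j.
  by rewrite gen ?index_enum_uniq.
elim: r => [|i r IHr] /=; first by rewrite !big_nil derivC.
case/andP => ir ur; rewrite !big_cons derivM IHr // eqxx /=; congr (_ + _).
  congr (_ * _); rewrite big_seq [RHS]big_seq_cond; apply: eq_bigl => j.
  by case jr: (j \in r) => //; rewrite andTb; apply/esym; apply: contraNneq ir => <-.
rewrite big_distrr /= big_seq [RHS]big_seq; apply: eq_bigr => j jr.
rewrite big_cons ifT; first by rewrite mulrCA.
by apply: contraNneq ir => ->.
Qed.

Lemma deriv_weight (V H : finType) (f : {ffun H -> V}) s :
  (weight f s)^`() = \sum_v weight_der f s v.
Proof. exact: deriv_prod. Qed.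

Definition all_sum (V H : finType) : {poly B} :=
  \sum_(f : {ffun H -> V}) \sum_(s : {ffun H -> H} | involb s) weight f s.

Definition conn_sum (V H : finType) : {poly B} :=
  \sum_(f : {ffun H -> V}) \sum_(s : {ffun H -> H} | involb s && skconn f s) weight f s.

Lemma weight_der_joinf (V1 V2 V H1 H2 H : finType) (S : {set V}) (T : {set H})
    (p : V1 + V2 -> V) p' (q : H1 + H2 -> H) q'
    (f1 : {ffun H1 -> V1}) (f2 : {ffun H2 -> V2}) s1 s2 v :
  splits S p p' -> splits T q q' ->
  weight_der (joinf p q' f1 f2) (joinf q q' s1 s2) (p (inl v))
    = weight_der f1 s1 v * weight f2 s2.
Proof.
move=> pS qT; rewrite /weight_der /weight /vweight.
rewrite (valence_inl pS qT) (legs_inl pS qT) -mulrA; congr (_ * _).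
have [pK p'K _ _] := pS.
rewrite (reindex p) /=; last by exists p' => x _; [apply: pK|apply: p'K].
rewrite big_sumType /=; congr (_ * _); apply: eq_big => w.
- by rewrite (inj_eq (can_inj pK)).
- by rewrite (valence_inl pS qT) (legs_inl pS qT).
- by rewrite (inj_eq (can_inj pK)).
- by rewrite (valence_inr pS qT) (legs_inr pS qT).
Qed.

(** When the component of v has vertex set S and set of half-edges T, the graph
splits along S and T. Conversely, in a disjoint union of graphs on S and on its
complement, S is the component of the marked vertex exactly when the first graph is
connected. *)
Lemma all_sum_split (V H : finType) (S : {set V}) (T : {set H}) :
  \sum_(f : {ffun H -> V}) \sum_(s | involb s)
     \sum_(v | (skcomp f s v == S) && (f @^-1: S == T)%SET) weight_der f s v
   = (conn_sum 'I_#|S| 'I_#|T|)^`() * all_sum 'I_#|~: S| 'I_#|~: T|.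
Proof.
have [p [p' pS]] := exists_splits S; have [q [q' qT]] := exists_splits T.
have [pK p'K pl pr] := pS; have [qK q'K ql qr] := qT.
pose X (f : {ffun H -> V}) (s : {ffun H -> H}) : {poly B} := if involb s then
  \sum_(v | (skcomp f s v == S) && (f @^-1: S == T)%SET) weight_der f s v else 0.
have X0 f s : ~~ (compat S T f && compat T T s) -> X f s = 0.
  move=> nc; rewrite /X; case: ifP => // /forallP inv; rewrite big_pred0 // => v.
  apply/negP => /andP [/eqP ES /eqP ET]; case/negP: nc.
  have adj y : (f y \in S) -> (f (s y) \in S).
    rewrite -ES !inE => vy; apply: connect_trans vy (connect1 _).
    by apply/existsP; exists y; rewrite !eqxx.
  apply/andP; split; apply/forallP => x; first by rewrite -ET inE.
  rewrite -ET !inE; apply/eqP; apply/idP/idP => [/adj|/adj //].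
  by rewrite (eqP (inv x)).
transitivity (\sum_(f | compat S T f) \sum_(s | compat T T s) X f s).
  rewrite [RHS]big_mkcond; apply: eq_bigr => f _.
  rewrite big_mkcond /= -/(X f _); case: ifP => cf; last first.
    by rewrite big1 // => s _; rewrite -[LHS]/(X f s) X0 ?cf.
  rewrite [RHS]big_mkcond; apply: eq_bigr => s _.
  by case cs: (compat T T s); rewrite -[LHS]/(X f s) // X0 ?cf ?cs.
rewrite (big_compat pS qT).
under eq_bigr do under eq_bigr do rewrite (big_compat qT qT).
transitivity (\sum_(f1 : {ffun 'I_#|T| -> 'I_#|S|}) \sum_(f2 : {ffun 'I_#|~: T| -> 'I_#|~: S|})
  \sum_(s1 | involb s1 && skconn f1 s1) \sum_(s2 | involb s2)
     (weight f1 s1)^`() * weight f2 s2).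
  apply: eq_bigr => f1 _; apply: eq_bigr => f2 _.
  rewrite [RHS]big_mkcond; apply: eq_bigr => s1 _.
  transitivity (\sum_s2 if (involb s1 && skconn f1 s1) && involb s2 then
    (weight f1 s1)^`() * weight f2 s2 else 0); last first.
    by case: (involb s1 && skconn f1 s1); rewrite -?big_mkcond // big1.
  apply: eq_bigr => s2 _.
  rewrite /X (involb_joinf qT); case: ifP => [/andP [i1 i2]|ni]; last first.
    by case: ifP => // /andP [/andP [i1 _] i2]; rewrite i1 i2 in ni.
  rewrite i1 i2 andbT /=.
  rewrite (reindex p) /=; last by exists p' => x _; [apply: pK|apply: p'K].
  rewrite big_sumType /= [X in _ + X]big_pred0 ?addr0; last first.
    by move=> v; rewrite (skcomp_joinf_inr q q' pS).
  rewrite (eq_bigl (fun _ => skconn f1 s1)); last first.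
    by move=> v; rewrite (skcomp_joinf_inl pS qT) // (preim_joinf pS qT) eqxx andbT.
  case: (skconn f1 s1); last by rewrite big_pred0_eq.
  rewrite deriv_weight big_distrl /=; apply: eq_bigr => v _.
  by rewrite (weight_der_joinf _ _ _ _ _ pS qT).
rewrite /conn_sum /all_sum linear_sum big_distrl /=; apply: eq_bigr => f1 _.
rewrite big_distrr /=; apply: eq_bigr => f2 _.
rewrite linear_sum big_distrl /=; apply: eq_bigr => s1 _.
by rewrite big_distrr.
Qed.

(** The exponential formula A' = C' A before normalization: the graphs with a
marked vertex are sorted by the vertices S and the half-edges T of its component. *)
Lemma deriv_all_sum (V H : finType) :
  (all_sum V H)^`() = \sum_(S : {set V}) \sum_(T : {set H})
    (conn_sum 'I_#|S| 'I_#|T|)^`() * all_sum 'I_#|~: S| 'I_#|~: T|.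
Proof.
under [RHS]eq_bigr do under eq_bigr do rewrite -all_sum_split.
rewrite /all_sum linear_sum.
under [RHS]eq_bigr do rewrite exchange_big /=.
rewrite exchange_big /=; apply: eq_bigr => f _.
under [RHS]eq_bigr do rewrite exchange_big /=.
rewrite exchange_big /= linear_sum /=; apply: eq_bigr => s _.
rewrite deriv_weight.
under [RHS]eq_bigr do rewrite (exchange_big_dep predT) //=.
rewrite exchange_big /=; apply: eq_bigr => v _.
rewrite (bigD1 (skcomp f s v)) //= [X in _ + X]big1 ?addr0; last first.
  by move=> S; rewrite eq_sym => /negbTE nS; rewrite big1 // => T; rewrite nS.
rewrite (bigD1 (f @^-1: skcomp f s v)%SET) ?eqxx //= big1 ?addr0 // => T.
by case/andP => /eqP ->; rewrite eqxx.
Qed.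

End Weights.

(** * Truncated power series *)

Section Truncation.
Variable B : comNzRingType.
Implicit Types p q z : {poly B}.

Definition eqm (N : nat) p q : Prop := forall i, (i < N)%N -> p`_i = q`_i.

Lemma eqm_sym N p q : eqm N p q -> eqm N q p.
Proof. by move=> E i iN; rewrite E. Qed.

Lemma eqm_trans N q p r : eqm N p q -> eqm N q r -> eqm N p r.
Proof. by move=> E1 E2 i iN; rewrite E1 ?E2. Qed.

Lemma eqm_le M N p q : (M <= N)%N -> eqm N p q -> eqm M p q.
Proof. by move=> MN E i iM; rewrite E // (leq_trans iM). Qed.

Lemma eqmD N p q p' q' : eqm N p q -> eqm N p' q' -> eqm N (p + p') (q + q').
Proof. by move=> E1 E2 i iN; rewrite !coefD E1 ?E2. Qed.

Lemma eqmM N p q p' q' : eqm N p q -> eqm N p' q' -> eqm N (p * p') (q * q').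
Proof.
move=> E1 E2 i iN; rewrite !coefM; apply: eq_bigr => -[j /= ji] _.
by rewrite E1 ?E2 //; lia.
Qed.

Lemma eqm_sum N I (r : seq I) (P : pred I) (F G : I -> {poly B}) :
  (forall i, P i -> eqm N (F i) (G i)) ->
  eqm N (\sum_(i <- r | P i) F i) (\sum_(i <- r | P i) G i).
Proof. by move=> E j jN; rewrite !coef_sum; apply: eq_bigr => i Pi; apply: E. Qed.

Lemma eqm_deriv N p q : eqm N.+1 p q -> eqm N p^`() q^`().
Proof. by move=> E i iN; rewrite !coef_deriv E. Qed.

Definition ordX (N : nat) p : Prop := eqm N p 0.

Lemma ordX_le M N p : (M <= N)%N -> ordX N p -> ordX M p.
Proof. exact: eqm_le. Qed.

Lemma ordX_0 p : ordX 0 p. Proof. by []. Qed.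

Lemma ordX_zero N : ordX N 0. Proof. by []. Qed.

Lemma ordXM M N p q : ordX M p -> ordX N q -> ordX (M + N) (p * q).
Proof.
move=> Ep Eq i iMN; rewrite coefM coef0 big1 // => -[j /= ji] _.
have [jM|Mj] := ltnP j M; first by rewrite Ep // coef0 mul0r.
by rewrite Eq ?coef0 ?mulr0 //; lia.
Qed.

Lemma ordXMl N p q : ordX N p -> ordX N (p * q).
Proof. by move=> Ep; rewrite -[N]addn0; apply: ordXM. Qed.

Lemma ordXMr N p q : ordX N q -> ordX N (p * q).
Proof. by rewrite mulrC; apply: ordXMl. Qed.

Lemma ordXZ N c p : ordX N p -> ordX N (c *: p).
Proof. by move=> Ep i iN; rewrite coefZ Ep // coef0 mulr0. Qed.

Lemma ordX_sum N I (r : seq I) (P : pred I) (F : I -> {poly B}) :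
  (forall i, P i -> ordX N (F i)) -> ordX N (\sum_(i <- r | P i) F i).
Proof.
by move=> E j jN; rewrite coef_sum big1 ?coef0 // => i Pi; rewrite E // coef0.
Qed.

Lemma ordX_prod I (r : seq I) (e : I -> nat) (F : I -> {poly B}) :
  (forall i, ordX (e i) (F i)) -> ordX (\sum_(i <- r) e i) (\prod_(i <- r) F i).
Proof.
move=> E; elim: r => [|i r IHr]; first by rewrite !big_nil.
by rewrite !big_cons; apply: ordXM.
Qed.

Lemma ordX_exp N p k : ordX N p -> ordX (k * N) (p ^+ k).
Proof.
move=> Ep; elim: k => [|k IHk]; first by [].
by rewrite exprS mulSn; apply: ordXM.
Qed.

Lemma ordX_deriv N p : ordX N p -> ordX N.-1 p^`().
Proof. by case: N => [//|N] /eqm_deriv; rewrite /ordX linear0. Qed.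

Lemma eqm_sub N p q : eqm N p q -> ordX N (p - q).
Proof. by move=> E i iN; rewrite coefB coef0 E // subrr. Qed.

(** A series with constant term 1 is not a zero divisor modulo q^N. *)
Lemma ordX_cancel N p z : z`_0 = 1 -> ordX N (p * z) -> ordX N p.
Proof.
move=> z0 E i; elim/ltn_ind: i => i IHi iN.
have := E i iN; rewrite coefM big_ord_recr /= subnn z0 mulr1 big1 ?add0r // => -[j /= ji] _.
by rewrite IHi ?coef0 ?mul0r // (ltn_trans ji).
Qed.

Lemma conv_triangle (R : nmodType) L (F : nat -> nat -> R) :
  \sum_(s < L) \sum_(x < s.+1) F x (s - x)%N
    = \sum_(x < L) \sum_(y < L - x) F x y.
Proof.
elim: L => [|L IHL]; first by rewrite !big_ord0.
rewrite big_ord_recr /= IHL.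
transitivity (\sum_(x < L.+1) (\sum_(y < L - x) F x y + F x (L - x)%N)).
  rewrite big_split /= [X in _ = X + _]big_ord_recr /= subnn big_ord0 addr0.
  by [].
by apply: eq_bigr => -[x /= xL] _; rewrite subSn // big_ord_recr.
Qed.

(** Truncating both factors of a Cauchy product at L instead of truncating the
product only adds terms of total degree at least L. *)
Lemma conv_box N L (F : nat -> nat -> {poly B}) :
  (forall x y, (L <= x + y)%N -> ordX N (F x y)) ->
  eqm N (\sum_(s < L) \sum_(x < s.+1) F x (s - x)%N) (\sum_(x < L) \sum_(y < L) F x y).
Proof.
move=> E; rewrite conv_triangle; apply: eqm_sum => x _.
have -> : \sum_(y < L) F x y = \sum_(y < L - x) F x y + \sum_(y < L | ~~ (y < L - x)%N) F x y.
  rewrite (bigID (fun y : 'I_L => (y < L - x)%N)) /=; congr (_ + _).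
  by rewrite (big_ord_widen L) ?leq_subr.
rewrite -[X in eqm N X _]addr0; apply: eqmD => //.
apply: eqm_sym; apply: ordX_sum => y; rewrite -leqNgt => xy; apply: E; lia.
Qed.

End Truncation.

Lemma pnat_regular (p : {poly rat}) n : p *+ n.+1 = 0 -> p = 0.
Proof.
move=> E; apply/polyP => i; have /eqP := congr1 (fun r : {poly rat} => r`_i) E.
by rewrite coefMn !coef0 mulrn_eq0 => /eqP.
Qed.

Definition log_trunc (N : nat) (z : {poly {poly rat}}) : {poly {poly rat}} :=
  \sum_(k < N) ((-1) ^+ k / k.+1%:R)%:P *: (z - 1) ^+ k.+1.

(** Term by term, the derivative of the logarithm is z' times a geometric series
in 1 - z. *)
Lemma deriv_log_trunc N z :
  (log_trunc N z)^`() * z = z^`() * (1 - (1 - z) ^+ N).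
Proof.
have -> : (log_trunc N z)^`() = z^`() * \sum_(k < N) (1 - z) ^+ k.
  rewrite linear_sum big_distrr /=; apply: eq_bigr => k _.
  rewrite derivZ deriv_exp /= derivB derivC subr0 -mulrnAr scalerAr; congr (_ * _).
  rewrite -scalerMnr scalerMnl -polyCMn -mulrnAr -[_ *+ k.+1]mulr_natr mulVf ?pnatr_eq0 // mulr1.
  rewrite -[1 - z]opprB [in RHS]exprNn -mul_polyC; congr (_ * _).
  by rewrite rmorphXn /= polyCN rmorphXn /= polyCN.
rewrite -mulrA; congr (_ * _).
have -> : 1 - (1 - z) ^+ N = - ((1 - z) ^+ N - 1) by rewrite opprB.
by rewrite subrX1 mulrC -mulNr opprB subKr.
Qed.

(** A power series is determined by its derivative and its constant term, so the
logarithmic derivative characterizes the logarithm. *)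
Lemma log_truncP N (z c : {poly {poly rat}}) :
  z`_0 = 1 -> c`_0 = 0 -> eqm N (c^`() * z) z^`() -> eqm N.+1 (log_trunc N z) c.
Proof.
move=> z0 c0 E; have z10 : (1 - z)`_0 = 0 by rewrite coefB coef1 z0 subrr.
have l0 : (log_trunc N z)`_0 = 0.
  rewrite /log_trunc coef_sum big1 // => k _; rewrite coefZ exprS.
  by rewrite coef0M coefB coef1 z0 subrr mul0r mulr0.
have ord1 : ordX N (log_trunc N z - c)^`().
  apply: (ordX_cancel z0); rewrite derivB mulrBl deriv_log_trunc.
  apply: eqm_sub; apply: eqm_sym; apply: (eqm_trans E).
  rewrite mulrBr mulr1 -[X in eqm N X]subr0; apply: eqmD => //.
  apply: eqm_sym; rewrite -mulNr oppr0 -[N in eqm N]muln1; apply/ordXMr/ordX_exp.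
  by move=> [_|//]; rewrite z10 coef0.
case=> [|i] iN; first by rewrite l0 c0.
have := ord1 i iN; rewrite coef_deriv coef0 => /pnat_regular.
by rewrite coefB => /subr0_eq.
Qed.

(** * Normalized sums over labelled graphs *)

Lemma sum_by_card (R : nmodType) (I : finType) (F : nat -> nat -> R) :
  \sum_(S : {set I}) F #|S| #|~: S|%SET
    = \sum_(i < #|I|.+1) F i (#|I| - i)%N *+ 'C(#|I|, i).
Proof.
pose card_ord (S : {set I}) : 'I_#|I|.+1 := inord #|S|.
have cE S : card_ord S = #|S| :> nat by rewrite inordK // ltnS max_card.
rewrite (partition_big card_ord predT) //=; apply: eq_bigr => i _.
rewrite (eq_bigr (fun _ => F i (#|I| - i)%N)); last first.
  move=> S /eqP <-; rewrite cE; congr (F _ _).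
  by apply/eqP; rewrite -(eqn_add2l #|S|) cardsC subnKC ?max_card.
rewrite sumr_const; congr (_ *+ _).
rewrite -card_draws -sum1_card -[RHS]sum1_card; apply: eq_bigl => S.
by rewrite inE -cE.
Qed.

Section Normalized.
Variable phi : nat -> nat -> {poly {poly rat}}.

(** The weight 1 / (k! h!) of exponential generating functions in two kinds of
labels. *)
Definition inv_labellings (k h : nat) : rat := ((k`! * h`!)%:R)^-1.

Definition all_egf (k h : nat) : {poly {poly rat}} :=
  (inv_labellings k h)%:P *: all_sum phi 'I_k 'I_h.

Definition conn_egf (k h : nat) : {poly {poly rat}} :=
  (inv_labellings k h)%:P *: conn_sum phi 'I_k 'I_h.

Lemma labellings_bin k h i j : (i <= k)%N -> (j <= h)%N ->
  inv_labellings k h *+ ('C(h, j) * 'C(k, i)) = inv_labellings i j * inv_labellings (k - i) (h - j).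
Proof.
move=> ik jh; rewrite /inv_labellings -(bin_fact ik) -(bin_fact jh) -mulr_natr !natrM.
field.
by rewrite !pnatr_eq0 -!lt0n !fact_gt0 !bin_gt0 ik jh.
Qed.

(** The binomials that count the possible S and T are absorbed by the
factorials. *)
Lemma deriv_all_egf k h :
  (all_egf k h)^`() = \sum_(i < k.+1) \sum_(j < h.+1) (conn_egf i j)^`() * all_egf (k - i) (h - j).
Proof.
rewrite /all_egf derivZ deriv_all_sum.
pose F a c b d := (conn_sum phi 'I_a 'I_b)^`() * all_sum phi 'I_c 'I_d.
rewrite (sum_by_card 'I_k (fun a c => \sum_(T : {set 'I_h}) F a c #|T| #|~: T|%SET)).
rewrite scaler_sumr !card_ord; apply: eq_bigr => -[i /= ik] _.
rewrite (sum_by_card 'I_h (F i (k - i)%N)) -sumrMnl scaler_sumr card_ord.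
apply: eq_bigr => -[j /= jh] _; rewrite /F /conn_egf derivZ.
rewrite -scalerAl -scalerAr scalerA -polyCM -labellings_bin //.
by rewrite -mulrnA polyCMn -scalerMnl -scalerMnr.
Qed.

End Normalized.

(** * Attaching half-edges: the Leibniz rule *)

Section Leibniz.
Variables (R : comNzRingType) (I : finType).

Definition ffun_cons a (i : I) (f : {ffun 'I_a -> I}) : {ffun 'I_a.+1 -> I} :=
  [ffun x => if unlift ord0 x is Some y then f y else i].

Lemma big_ffun_cons (M : nmodType) a (F : {ffun 'I_a.+1 -> I} -> M) :
  \sum_f F f = \sum_i \sum_f F (ffun_cons i f).
Proof.
rewrite pair_big /= (reindex (fun g => ffun_cons g.1 g.2)) //=.
exists (fun f => (f ord0, [ffun y => f (lift ord0 y)])) => [[i f]|f] _ /=.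
  congr (_, _); first by rewrite ffunE unlift_none.
  by apply/ffunP => y; rewrite !ffunE liftK.
by apply/ffunP => x; rewrite ffunE; case: unliftP => [y|] ->; rewrite ?ffunE.
Qed.

(** The new half-edge, attached to i, adds one to the valence of i only. *)
Lemma valence_cons a i (f : {ffun 'I_a -> I}) j :
  valence (ffun_cons i f) j = ((i == j) + valence f j)%N.
Proof.
rewrite /valence -!sum1dep_card big_mkcond big_ord_recl ffunE unlift_none.
rewrite [in RHS]big_mkcond; congr (_ + _)%N.
by apply: eq_bigr => y _; rewrite ffunE liftK.
Qed.

(** The map f records on which factor each of the a derivatives falls. *)
Lemma derivn_prod (F : I -> {poly R}) a :
  (\prod_i F i)^`(a) = \sum_(f : {ffun 'I_a -> I}) \prod_i (F i)^`(valence f i).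
Proof.
elim: a => [|a IHa].
  transitivity (\sum_(f : {ffun 'I_0 -> I}) \prod_i F i).
    by rewrite sumr_const card_ffun card_ord expn0.
  apply: eq_bigr => f _; apply: eq_bigr => i _.
  by rewrite /valence eq_card0 // => -[].
rewrite derivnS IHa linear_sum big_ffun_cons exchange_big /=.
apply: eq_bigr => f _; rewrite deriv_prod; apply: eq_bigr => i _.
rewrite [RHS](bigD1 i) //= valence_cons eqxx -derivnS; congr (_ * _).
by apply: eq_bigr => j; rewrite valence_cons eq_sym => /negbTE ->.
Qed.

(** Taylor coefficients of the Leibniz rule: attaching a half-edges to the vertices
in all possible ways. *)
Lemma coef_prod (F : I -> {poly R}) a :
  (\prod_i F i)`_a *+ a`!
    = \sum_(f : {ffun 'I_a -> I}) \prod_i ((F i)`_(valence f i) *+ (valence f i)`!).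
Proof.
have derivn_coef0 (p : {poly R}) n : p^`(n)`_0 = p`_n *+ n`!.
  by rewrite coef_derivn addn0 ffactnn.
rewrite -derivn_coef0 derivn_prod coef_sum; apply: eq_bigr => f _.
rewrite -horner_coef0 horner_prod; apply: eq_bigr => i _.
by rewrite horner_coef0 derivn_coef0.
Qed.

End Leibniz.

(** * Involutions and Gaussian moments *)

Definition fixpoints (H : finType) (s : {ffun H -> H}) : nat :=
  #|[set x | s x == x]%SET|.

(** Matchings of a half-edges with some of them left as legs, each leg counted by a
factor 'X (a Hermite polynomial with positive signs). *)
Definition inv_poly (a : nat) : {poly rat} :=
  \sum_(s : {ffun 'I_a -> 'I_a} | involb s) 'X^(fixpoints s).

Lemma fixpoints_joinf (H1 H2 H : finType) (T : {set H}) (q : H1 + H2 -> H) q' s1 s2 :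
  splits T q q' ->
  fixpoints (joinf q q' s1 s2) = (fixpoints s1 + fixpoints s2)%N.
Proof.
move=> qT; have qinj := splits_inj qT.
rewrite /fixpoints (card_splits qT); congr (_ + _)%N; apply: eq_card => x.
  by rewrite !inE (joinf_inl _ qT) (inj_eq qinj).
by rewrite !inE (joinf_inr _ qT) (inj_eq qinj).
Qed.

(** The involutions that exchange x and y (or fix x, when y = x) are the
involutions of the complement. *)
Lemma inv_poly_image (H : finType) (x y : H) :
  \sum_(s : {ffun H -> H} | involb s && (s x == y)) 'X^(fixpoints s)
    = (if x == y then 'X else 1) * inv_poly #|~: [set x; y]|%SET :> {poly rat}.
Proof.
pose T := [set x; y]%SET.
have [q [q' qT]] := exists_splits T; have [qK q'K ql qr] := qT.
have qinj := splits_inj qT.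
have memT z : z \in T -> exists z1, z = q (inl z1).
  by move=> zT; case E: (q' z) => [z1|z1];
    [exists z1; rewrite -E q'K | have := qr z1; rewrite -E q'K zT].
have [x1 xE] : exists z1, x = q (inl z1) by apply: memT; rewrite !inE eqxx.
have [y1 yE] : exists z1, y = q (inl z1) by apply: memT; rewrite !inE eqxx orbT.
have onT z1 : z1 = x1 \/ z1 = y1.
  have := ql z1; rewrite !inE xE yE !(inj_eq qinj).
  by case/orP => /eqP [->]; [left|right].
transitivity (\sum_(s : {ffun H -> H} | compat T T s && (involb s && (s x == y)))
    'X^(fixpoints s) : {poly rat}).
  apply: eq_bigl => s; case inv: (involb s && _); last by rewrite andbF.
  case/andP: inv => /forallP inv /eqP sx; rewrite andbT; apply/esym/forallP => z.
  have sy : s y = x by rewrite -sx (eqP (inv x)).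
  rewrite !inE; apply/eqP; apply/orP/orP => -[]/eqP E.
  - by right; rewrite -sx -E (eqP (inv z)).
  - by left; rewrite -sy -E (eqP (inv z)).
  - by right; rewrite E sx.
  - by left; rewrite E sy.
rewrite big_mkcondr /= (big_compat qT qT).
(* on T = {x, y}, the exchange of x and y is the only possibility *)
pose s0 : {ffun 'I_#|T| -> 'I_#|T|} := [ffun z => if z == x1 then y1 else x1].
have s0E s1 : involb s1 && (s1 x1 == y1) = (s1 == s0).
  apply/andP/eqP => [[/forallP inv /eqP sx]|->].
    have sy : s1 y1 = x1 by rewrite -sx (eqP (inv x1)).
    apply/ffunP => z; rewrite ffunE; case: eqP => [->//|].
    by case: (onT z) => -> // _.
  rewrite ffunE eqxx; split=> //; apply/forallP => z.
  case: (onT z) => ->; rewrite !ffunE ?eqxx; have [E|nyx] := eqVneq y1 x1;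
    by rewrite ?E ?eqxx.
transitivity (\sum_(s1 | s1 == s0) \sum_(s2 : {ffun 'I_#|~: T| -> 'I_#|~: T|} | involb s2)
    'X^(fixpoints s1) * 'X^(fixpoints s2) : {poly rat}).
  rewrite [RHS]big_mkcond; apply: eq_bigr => s1 _; rewrite -s0E.
  transitivity (\sum_(s2 : {ffun 'I_#|~: T| -> 'I_#|~: T|})
     (if (involb s1 && (s1 x1 == y1)) && involb s2 then
    'X^(fixpoints s1) * 'X^(fixpoints s2) else 0) : {poly rat}); last first.
    by case: (involb s1 && _); rewrite -?big_mkcond // big1.
  apply: eq_bigr => s2 _; rewrite (involb_joinf qT) (fixpoints_joinf _ _ qT).
  by rewrite exprD xE yE (joinf_inl _ qT) (inj_eq qinj) andbAC.
rewrite big_pred1_eq -big_distrr /=; congr (_ * _).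
rewrite xE yE (inj_eq qinj) -[inl _ == _]/(x1 == y1).
have [exy|nxy] := eqVneq x1 y1.
  rewrite /fixpoints (_ : [set x | _]%SET = [set x1]%SET) ?cards1 //.
  apply/setP => z; rewrite !inE ffunE -exy.
  have -> : z = x1 by case: (onT z) => //; rewrite -exy.
  by rewrite !eqxx.
have -> // : fixpoints s0 = 0%N.
apply: eq_card0 => z; rewrite !inE ffunE.
have nyx : y1 != x1 by rewrite eq_sym.
by case: (onT z) => ->; rewrite ?eqxx !(negbTE nyx, negbTE nxy).
Qed.

(** The first point is fixed or is exchanged with one of the a others. *)
Lemma inv_polyS a : inv_poly a.+1 = 'X * inv_poly a + inv_poly a.-1 *+ a.
Proof.
rewrite {1}/inv_poly (partition_big (fun s : {ffun 'I_a.+1 -> 'I_a.+1} => s ord0) predT) //=.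
under eq_bigr do rewrite inv_poly_image.
rewrite (bigD1 ord0) //= ?eqxx finset.setUid; congr (_ * inv_poly _ + _).
  by rewrite cardsC1 card_ord.
rewrite (eq_bigr (fun _ => inv_poly a.-1)); last first.
  move=> y; rewrite eq_sym => y0; rewrite (negbTE y0) mul1r; congr inv_poly.
  by rewrite cardsCs finset.setCK card_ord cards2 y0 subSS subn1.
by rewrite sumr_const (cardC1 (ord0 : 'I_a.+1)) card_ord.
Qed.

Lemma inv_poly0 : inv_poly 0 = 1.
Proof.
rewrite /inv_poly (eq_bigl predT); last by move=> s; apply/forallP; case.
rewrite (eq_bigr (fun _ => 1)) => [|s _].
  by rewrite sumr_const card_ffun card_ord expn0.
by rewrite /fixpoints eq_card0 // => -[].
Qed.

Lemma gauss_momentSS m : gauss_moment m.+2 = m.+1%:R * gauss_moment m.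
Proof.
rewrite /gauss_moment /= negbK; case: ifP => [_|om]; first by rewrite mulr0.
rewrite big_ord_recr /= natrM mulrC; congr (_%:R * _).
by rewrite mul2n addn1 even_halfK // om.
Qed.

(** The truncation of the series that integrates x^a exp(Yx) against the Gaussian
weight. *)
Definition gauss_poly (L a : nat) : {poly rat} :=
  \poly_(b < L) (gauss_moment (a + b) / b`!%:R).

(** Integration by parts. *)
Lemma gauss_polyS L a :
  eqm L (gauss_poly L a.+1) ('X * gauss_poly L a + gauss_poly L a.-1 *+ a).
Proof.
move=> [|b] bL; rewrite !coef_poly ?coefD ?coefXM ?coefMn ?coef_poly bL /=.
  rewrite ?bL !divr1 addn0 add0r; case: a => [|a]; first by rewrite mulr0n.
  by rewrite addn0 gauss_momentSS mulr_natl.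
rewrite ?bL (ltnW bL); case: a => [|a] /=.
  rewrite mulr0n addr0 add0n add1n gauss_momentSS factS natrM.
  by field; rewrite nat1r !pnatr_eq0 -lt0n fact_gt0.
rewrite !(addSn, addnS) !gauss_momentSS factS natrM -mulr_natr.
rewrite -[(a + b).+2]addn2 -[b.+1]addn1 -[a.+1]addn1 !natrD.
field.
by rewrite natr1 !pnatr_eq0 -lt0n fact_gt0.
Qed.

(** Both sides satisfy the same recurrence in a. The factor for a = 0, the series
of exp(Y^2/2), stands for the legs that are matched with each other. *)
Lemma gauss_poly_inv L a : eqm L (gauss_poly L a) (gauss_poly L 0 * inv_poly a).
Proof.
elim/ltn_ind: a => -[|a] IHa; first by rewrite inv_poly0 mulr1.
apply: (eqm_trans (@gauss_polyS L a)).
rewrite inv_polyS mulrDr mulrCA; apply: eqmD.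
  by apply: eqmM => //; apply: IHa.
rewrite mulrnAr => i iL; rewrite !coefMn; congr (_ *+ _).
by apply: IHa => //; case: (a).
Qed.

(** The differential equation of exp(Y^2/2). *)
Lemma deriv_gauss_poly L :
  eqm L (gauss_poly L.+1 0)^`() ('X * gauss_poly L.+1 0).
Proof.
apply: (@eqm_trans _ L (gauss_poly L.+1 1)); last first.
  apply: (eqm_le (leqnSn L)).
  by apply: (eqm_trans (@gauss_polyS L.+1 0)); rewrite mulr0n addr0.
move=> b bL; rewrite coef_deriv !coef_poly !ltnS bL ltnW // add0n add1n.
rewrite factS natrM -mulr_natr.
by field; rewrite nat1r !pnatr_eq0 -lt0n fact_gt0.
Qed.

(** * The logarithm of the Gaussian integral *)

Lemma legs_sum (V H : finType) (f : {ffun H -> V}) (s : {ffun H -> H}) :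
  (\sum_v legs f s v = fixpoints s)%N.
Proof.
rewrite /fixpoints -sum1dep_card (partition_big f predT) //=.
apply: eq_bigr => v _; rewrite /legs -sum1dep_card.
by apply: eq_bigl => x; rewrite andbC.
Qed.

Lemma valence_sum (V H : finType) (f : {ffun H -> V}) :
  (\sum_v valence f v = #|H|)%N.
Proof.
rewrite -sum1_card (partition_big f predT) //=.
by apply: eq_bigr => v _; rewrite /valence -sum1dep_card.
Qed.

Definition subst_poly (U : {poly {poly rat}}) (g : {poly rat}) : {poly {poly rat}} :=
  map_poly polyC g \Po U.

Lemma subst_eqm L U g h : ordX 1 U -> eqm L g h -> eqm L (subst_poly U g) (subst_poly U h).
Proof.
move=> U1 E; suff: ordX L (subst_poly U g - subst_poly U h).
  by move=> E' i iL; have := E' i iL; rewrite coefB coef0 => /subr0_eq.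
rewrite /subst_poly -comp_polyB -rmorphB comp_polyE; apply: ordX_sum => i _.
have [iL|Li] := ltnP i L.
  by rewrite coef_map coefB E // subrr scale0r; apply: ordX_zero.
apply: ordXZ; apply: (ordX_le Li).
by have := @ordX_exp _ 1 U i U1; rewrite muln1.
Qed.

Lemma substM U g h : subst_poly U (g * h) = subst_poly U g * subst_poly U h.
Proof. by rewrite /subst_poly rmorphM comp_polyM. Qed.

Lemma subst_sumXn U (I : finType) (P : pred I) (c : I -> rat) (e : I -> nat) :
  subst_poly U (\sum_(i | P i) c i *: 'X^(e i)) = \sum_(i | P i) (c i)%:P *: U ^+ e i.
Proof.
rewrite /subst_poly rmorph_sum /= linear_sum /=; apply: eq_bigr => i _.
by rewrite map_polyZ map_polyXn comp_polyZ comp_Xn_poly.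
Qed.

Section Gaussian.
Variables (N : nat) (W : nat -> {poly {poly rat}}) (U : {poly {poly rat}}).
Hypothesis W_ord : forall n, ordX (maxn 1 (n - 2)) (W n).
Hypothesis U_ord : ordX 1 U.

Let L := (3 * N).+1.
Let M := L.+2.

Definition wphi (n m : nat) : {poly {poly rat}} := W n * U ^+ m.

Definition act_vertex : {poly {poly {poly rat}}} :=
  \poly_(n < M) ((n`!%:R^-1)%:P *: W n).

(** The exponent of the integrand without its quadratic part: a polynomial in x over
the truncated series in q. The bound M exceeds every power of x that survives modulo
q^(N+1) after integration. *)
Definition act : {poly {poly {poly rat}}} := act_vertex + U *: 'X.

Definition exp_trunc (p : {poly {poly {poly rat}}}) : {poly {poly {poly rat}}} :=
  \sum_(l < L) (l`!%:R^-1)%:P%:P *: p ^+ l.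

(** The integral is truncated at x^(3N+1): every power of x comes with at least a
third of it in powers of q, the extreme case being a trivalent vertex of genus 0. *)
Definition Zpoly : {poly {poly rat}} :=
  \sum_(j < L) (gauss_moment j)%:P *: (exp_trunc act)`_j.

Definition Apoly : {poly {poly rat}} :=
  \sum_(a < L) \sum_(l < L) all_egf wphi l a.

Definition Cpoly : {poly {poly rat}} :=
  \sum_(a < L) \sum_(l < L) conn_egf wphi l a.

Lemma weight_wphi (V H : finType) (f : {ffun H -> V}) s :
  weight wphi f s = \prod_v W (valence f v) * U ^+ fixpoints s.
Proof.
rewrite /weight /vweight /wphi big_split /= -(legs_sum f s); congr (_ * _).
by rewrite prodrXr.
Qed.

(** A vertex contributes at least q, and at least a third of its valence. *)
Lemma weight_ord (V H : finType) (f : {ffun H -> V}) s :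
  ordX (maxn #|V| ((#|H| + 2) %/ 3)) (weight wphi f s).
Proof.
rewrite weight_wphi; apply: ordXMl.
apply: ordX_le (@ordX_prod _ _ (index_enum V) _ _ (fun v => @W_ord (valence f v))).
rewrite geq_max -{1}sum1_card leq_sum /= => [|v _]; last by lia.
have : (#|H| <= \sum_v 3 * maxn 1 (valence f v - 2))%N.
  by rewrite -(valence_sum f); apply: leq_sum => v _; lia.
by rewrite -big_distrr /=; lia.
Qed.

Lemma all_egf_ord l a : ordX (maxn l ((a + 2) %/ 3)) (all_egf wphi l a).
Proof.
apply: ordXZ; apply: ordX_sum => f _; apply: ordX_sum => s _.
by have := weight_ord f s; rewrite !card_ord.
Qed.

Lemma conn_egf_ord l a : ordX (maxn l ((a + 2) %/ 3)) (conn_egf wphi l a).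
Proof.
apply: ordXZ; apply: ordX_sum => f _; apply: ordX_sum => s _.
by have := weight_ord f s; rewrite !card_ord.
Qed.

Lemma act_vertex_exp_ord l a : ordX ((a + 2) %/ 3) ((act_vertex ^+ l)`_a).
Proof.
elim: l a => [|l IHl] a.
  by rewrite expr0 coef1; case: a => [|a]; [apply: ordX_0 | apply: ordX_zero].
rewrite exprS coefM; apply: ordX_sum => -[j /= ja] _.
apply: ordX_le (ordXM (M := (j + 2) %/ 3) _ (IHl _)); first by lia.
rewrite coef_poly; case: ifP => _; last exact: ordX_zero.
by apply: ordXZ; apply: ordX_le (@W_ord j); lia.
Qed.

Lemma act_vertex_coef0 : W 0 = 0 -> ordX 1 act_vertex.
Proof. by move=> W0 [|//] _; rewrite coef_poly W0 scaler0 coef0. Qed.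

(** exp(Ux + S) = exp(Ux) exp(S) modulo x^L. *)
Lemma exp_trunc_act : W 0 = 0 ->
  eqm L (exp_trunc act) (exp_trunc (U *: 'X) * exp_trunc act_vertex).
Proof.
move=> W0.
pose F b y := ((b`!%:R^-1)%:P%:P *: (U *: 'X) ^+ b)
  * ((y`!%:R^-1)%:P%:P *: act_vertex ^+ y) : {poly {poly {poly rat}}}.
have -> : exp_trunc act = \sum_(l < L) \sum_(b < l.+1) F b (l - b)%N.
  apply: eq_bigr => l _; rewrite /act exprDn scaler_sumr.
  apply: eq_bigr => -[b /=]; rewrite ltnS => bl _.
  rewrite /F mulrC -scalerAl -scalerAr scalerA -scalerMnr scalerMnl; congr (_ *: _).
  rewrite -!polyCM -!polyCMn; congr (_%:P%:P).
  rewrite -(bin_fact bl) -mulr_natr !natrM; field.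
  by rewrite !pnatr_eq0 -!lt0n !fact_gt0 bin_gt0.
have -> : exp_trunc (U *: 'X) * exp_trunc act_vertex = \sum_(b < L) \sum_(y < L) F b y.
  by rewrite /exp_trunc big_distrl; apply: eq_bigr => b _; rewrite big_distrr.
apply: conv_box => b y Lby; apply: (ordX_le Lby).
apply: ordXM; apply: ordXZ; rewrite -[X in ordX X]muln1; apply: ordX_exp.
  by move=> [|//] _; rewrite coefZ coefX mulr0 coef0.
exact: act_vertex_coef0.
Qed.

Lemma exp_trunc_UX b : (b < L)%N ->
  (exp_trunc (U *: 'X))`_b = (b`!%:R^-1)%:P *: U ^+ b.
Proof.
move=> bL; rewrite /exp_trunc coef_sum (bigD1 (Ordinal bL)) //= big1 ?addr0; last first.
  move=> i; rewrite -val_eqE /= => ib.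
  by rewrite exprZn !coefZ coefXn eq_sym (negbTE ib) !mulr0.
by rewrite exprZn !coefZ coefXn eqxx mulr1 mul_polyC.
Qed.

(** The half-edges are first attached to the vertices, then glued. *)
Lemma all_egf_act_vertex l a : (a < L)%N ->
  all_egf wphi l a = ((l`!%:R^-1)%:P *: (act_vertex ^+ l)`_a) * subst_poly U (inv_poly a).
Proof.
move=> aL; have := coef_prod (fun _ : 'I_l => act_vertex) a.
rewrite prodr_const card_ord => E.
have {}E : (act_vertex ^+ l)`_a =
    (a`!%:R^-1)%:P *: \sum_(f : {ffun 'I_a -> 'I_l}) \prod_v W (valence f v).
  transitivity ((a`!%:R^-1)%:P *: ((act_vertex ^+ l)`_a *+ a`!)).
    rewrite -scalerMnr scalerMnl -polyCMn -[_ *+ a`!]mulr_natr mulVf ?scale1r //.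
    by rewrite pnatr_eq0 -lt0n fact_gt0.
  rewrite E; congr (_ *: _); apply: eq_bigr => f _; apply: eq_bigr => v _.
  have vM : (valence f v < M)%N.
    by apply: leq_ltn_trans (max_card _) _; rewrite card_ord; lia.
  rewrite coef_poly vM scalerMnl -polyCMn.
  rewrite -[_ *+ (valence f v)`!]mulr_natr mulVf ?scale1r //.
  by rewrite pnatr_eq0 -lt0n fact_gt0.
have evE : subst_poly U (inv_poly a) = \sum_(s : {ffun 'I_a -> 'I_a} | involb s) U ^+ fixpoints s.
  rewrite -(eq_bigr _ (fun s _ => scale1r (U ^+ fixpoints s))) -polyC1 -subst_sumXn.
  by congr (subst_poly U _); apply: eq_bigr => s _; rewrite scale1r.
rewrite E evE scalerA -scalerAl -polyCM /all_egf; congr (_ *: _).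
  by rewrite /inv_labellings natrM invfM mulrC.
rewrite /all_sum big_distrl; apply: eq_bigr => f _; rewrite big_distrr.
by apply: eq_bigr => s _; rewrite weight_wphi.
Qed.

(** For each a, the coefficient of x^a in exp(S) multiplies the integral of
x^a exp(Ux). *)
Lemma Zpoly_eqm : W 0 = 0 -> eqm N.+1 Zpoly (subst_poly U (gauss_poly L 0) * Apoly).
Proof.
move=> W0.
pose E a := (exp_trunc act_vertex)`_a.
pose F b a := (gauss_moment (a + b) / b`!%:R)%:P *: U ^+ b * E a.
have -> : Zpoly = \sum_(j < L) \sum_(b < j.+1) F b (j - b)%N.
  apply: eq_bigr => -[j /= jL] _; rewrite (exp_trunc_act W0) // coefM scaler_sumr.
  apply: eq_bigr => -[b /= bj] _; rewrite exp_trunc_UX; last by lia.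
  by rewrite /F subnK // -scalerAl scalerA -scalerAl -polyCM.
have E_ord a : ordX ((a + 2) %/ 3) (E a).
  rewrite /E /exp_trunc coef_sum; apply: ordX_sum => l _; rewrite coefZ mul_polyC.
  by apply: ordXZ; apply: act_vertex_exp_ord.
apply: eqm_trans (conv_box _) _.
  move=> b a Lba; apply: ordX_le (ordXM (M := b) _ (E_ord a)); first by lia.
  by apply: ordXZ; have := @ordX_exp _ 1 U b U_ord; rewrite muln1.
rewrite exchange_big /Apoly big_distrr /=; apply: eqm_sum => a _.
have -> : \sum_(b < L) F b a = subst_poly U (gauss_poly L a) * E a.
  by rewrite -big_distrl /= /gauss_poly poly_def subst_sumXn.
have -> : \sum_(l < L) all_egf wphi l a = subst_poly U (inv_poly a) * E a.
  rewrite /E /exp_trunc coef_sum big_distrr /=; apply: eq_bigr => l _.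
  by rewrite all_egf_act_vertex // mulrC coefZ mul_polyC.
rewrite mulrA -substM; apply: eqmM => //.
apply: (eqm_le (N := L)); first by lia.
by apply: subst_eqm => //; apply: gauss_poly_inv.
Qed.

Lemma deriv_Apoly : eqm N Apoly^`() (Cpoly^`() * Apoly).
Proof.
pose F i j x y := (conn_egf wphi i j)^`() * all_egf wphi x y.
have F_ord i j x y n : (n < maxn (i + x) ((j + 2) %/ 3 + (y + 2) %/ 3))%N ->
    ordX n (F i j x y).
  move=> nlt; apply: ordX_le (ordXM (ordX_deriv (@conn_egf_ord i j)) (@all_egf_ord x y)).
  by lia.
have -> : Apoly^`() = \sum_(a < L) \sum_(j < a.+1)
    \sum_(l < L) \sum_(i < l.+1) F i j (l - i)%N (a - j)%N.
  rewrite /Apoly linear_sum; apply: eq_bigr => a _; rewrite exchange_big /=.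
  rewrite linear_sum /=; apply: eq_bigr => l _.
  by rewrite deriv_all_egf exchange_big.
(* the two convolutions, in the numbers of vertices and of half-edges, are
   replaced by products one after the other *)
apply: (@eqm_trans _ _ (\sum_(a < L) \sum_(j < a.+1)
    \sum_(i < L) \sum_(x < L) F i j x (a - j)%N)).
  apply: eqm_sum => a _; apply: eqm_sum => j _.
  apply: (@conv_box _ N L (fun i x => F i j x (a - j)%N)) => i x Lix.
  by apply: F_ord; lia.
have -> : Cpoly^`() * Apoly = \sum_(j < L) \sum_(y < L) \sum_(i < L) \sum_(x < L) F i j x y.
  rewrite linear_sum big_distrl /=; apply: eq_bigr => j _.
  rewrite linear_sum big_distrr /=; apply: eq_bigr => y _.
  rewrite big_distrl /=; apply: eq_bigr => i _.
  by rewrite big_distrr.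
apply: (@conv_box _ N L (fun j y => \sum_(i < L) \sum_(x < L) F i j x y)) => j y Ljy.
by apply: ordX_sum => i _; apply: ordX_sum => x _; apply: F_ord; lia.
Qed.

Lemma Apoly0 : Apoly`_0 = 1.
Proof.
have all_egf1 l a : (0 < maxn l ((a + 2) %/ 3))%N -> (all_egf wphi l a)`_0 = 0.
  by move=> pos; rewrite (@all_egf_ord l a) ?coef0.
rewrite /Apoly big_ord_recl coefD [X in _ + X]coef_sum [X in _ + X]big1 ?addr0; last first.
  move=> a _; rewrite coef_sum big1 // => l _; apply: all_egf1; rewrite lift0; lia.
rewrite big_ord_recl coefD [X in _ + X]coef_sum [X in _ + X]big1 ?addr0; last first.
  by move=> l _; apply: all_egf1; rewrite lift0; lia.
rewrite all_egf_act_vertex // expr0 coef1 inv_poly0 -polyC1 /subst_poly map_polyC comp_polyC.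
by rewrite fact0 invr1 scale1r mulr1 coefC.
Qed.

Lemma Cpoly0 : Cpoly`_0 = 0.
Proof.
rewrite /Cpoly coef_sum big1 // => a _; rewrite coef_sum big1 // => l _.
have [pos|] := ltnP 0 (maxn l ((a + 2) %/ 3)); first by rewrite (@conn_egf_ord l a) ?coef0.
rewrite leqn0 => m0; have -> : l = 0%N :> nat by lia.
rewrite /conn_egf /conn_sum big1 ?scaler0 ?coef0 // => f _; rewrite big_pred0 // => s.
by apply/negP => /andP [_ /skconn_inh [[]]].
Qed.

Lemma Zpoly0 : W 0 = 0 -> Zpoly`_0 = 1.
Proof.
move=> W0; have ZE := Zpoly_eqm W0.
have L0 : (0 < L)%N by [].
rewrite ZE // coef0M Apoly0 mulr1.
have G1 : eqm 1 (gauss_poly L 0) 1.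
  by case=> // _; rewrite coef_poly L0 addn0 coef1 /gauss_moment /= big_ord0 divr1.
by rewrite (subst_eqm U_ord G1) // /subst_poly rmorph1 comp_polyC coef1.
Qed.

(** Z = exp(U^2/2) A has logarithmic derivative (U^2/2)' + C'. *)
Lemma log_Zpoly : W 0 = 0 ->
  eqm N.+1 (log_trunc N Zpoly) (Cpoly + (2%:R^-1)%:P *: U ^+ 2).
Proof.
move=> W0; have ZE := Zpoly_eqm W0.
have U0 : U`_0 = 0 by rewrite U_ord ?coef0.
apply: log_truncP.
- exact: Zpoly0.
- by rewrite coefD Cpoly0 coefZ expr2 coef0M U0 mulr0 mulr0 addr0.
apply: eqm_trans (eqm_sym (eqm_deriv ZE)).
apply: (@eqm_trans _ _ ((Cpoly + (2%:R^-1)%:P *: U ^+ 2)^`()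
    * (subst_poly U (gauss_poly L 0) * Apoly))).
  by apply: eqmM => //; apply: (eqm_le (leqnSn N)).
rewrite derivM derivD mulrDl addrC; apply: eqmD.
  rewrite mulrA; apply: eqmM => //.
  have -> : ((2%:R^-1)%:P *: U ^+ 2)^`() = U * U^`().
    rewrite derivZ deriv_exp /= expr1 -scalerMnr scalerMnl -polyCMn.
    by rewrite -[_ *+ 2]mulr_natr mulVf ?pnatr_eq0 // scale1r mulrC.
  rewrite {2}/subst_poly deriv_comp deriv_map mulrAC; apply: eqmM => //.
  have -> : U * subst_poly U (gauss_poly L 0) = subst_poly U ('X * gauss_poly L 0).
    by rewrite substM {2}/subst_poly map_polyX comp_polyX.
  apply: (eqm_le (N := 3 * N)); first by lia.
  by apply: eqm_sym; apply: subst_eqm => //; apply: deriv_gauss_poly.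
rewrite mulrCA; apply: eqmM => //; apply: eqm_sym; exact: deriv_Apoly.
Qed.

End Gaussian.

(** * Isomorphism classes against labelled graphs *)

(** The orbit of x has #|aT| / #|'C[x | to]| elements, on which F is constant. *)
Lemma sum_transversal (aT : finGroupType) (rT : finType)
    (to : {action aT &-> rT}) (r : rel rT) (D : {set rT}) (F : rT -> rat) :
  (forall x y, r x y = (y \in orbit to [set: aT]%SET x)) ->
  (forall x a, x \in D -> to x a \in D) -> (forall x a, F (to x a) = F x) ->
  \sum_(x in transversal (equivalence_partition r D) D)
     (#|('C[x | to])%g|%:R)^-1 * F x
   = (#|aT|%:R)^-1 * \sum_(x in D) F x.
Proof.
move=> rE Dto Fto; set P := equivalence_partition r D.
have eqr : {in D & &, equivalence_rel r}.
  move=> x y z _ _ _; rewrite !rE orbit_refl; split=> // xy.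
  by have /orbit_eqP -> := xy.
have partP := equivalence_partitionP eqr.
have trP := transversalP partP.
have XD := fintype.subsetP (transversal_sub trP).
rewrite (set_partition_big _ partP) /= -(pblock_transversal trP).
rewrite [in RHS]big_imset /=; last exact: (pblock_inj trP).
rewrite mulr_sumr; apply: eq_bigr => x /XD xD.
have -> : finset.pblock P x = orbit to [set: aT]%SET x.
  apply/setP => y; case yD: (y \in D); first by rewrite pblock_equivalence_partition // rE.
  have -> : (y \in finset.pblock P x) = false.
    apply: contraFF yD => yP; rewrite -(cover_partition partP); apply/finset.bigcupP.
    by exists (finset.pblock P x) => //; rewrite pblock_mem // (cover_partition partP).
  by apply/esym/negP => /orbitP [a _ E]; rewrite -E Dto in yD.
rewrite (eq_bigr (fun _ => F x)); last by move=> y /orbitP [a _ <-]; apply: Fto.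
rewrite sumr_const -[F x *+ _]mulr_natl mulrA; congr (_ * _).
have := card_orbit_stab to [set: aT]%G x; rewrite finset.setTI cardsT => <-.
rewrite natrM invfM mulrC mulrA divff ?mul1r //.
by rewrite pnatr_eq0 -lt0n; apply/card_gt0P; exists x; apply: orbit_refl.
Qed.

Section Relabel.
Variables (g : nat) (V H : finType).
Implicit Types (G : graph g V H) (p : ({perm V} * {perm H})%type).

Definition relabel G p : graph g V H :=
  ([ffun v => G.1.1 (p.1^-1%g v)], [ffun x => p.1 (G.1.2 (p.2^-1%g x))],
   [ffun x => p.2 (G.2 (p.2^-1%g x))]).

Lemma relabel1 : relabel^~ 1%g =1 id.
Proof.
move=> [[ga f] s]; congr (_, _, _); apply/ffunP => x;
  by rewrite ffunE /= ?invg1 ?perm1.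
Qed.

Lemma relabelM G : act_morph relabel G.
Proof.
by move=> p q; congr (_, _, _); apply/ffunP => x;
  rewrite !ffunE /= ?invMg ?permM.
Qed.

Definition relabel_action := TotalAction relabel1 relabelM.

Lemma is_isoE p G G' : is_iso p G G' = (relabel G p == G').
Proof.
apply/and3P/eqP => [[/forallP gE /forallP aE /forallP sE]|<-].
  case: G G' gE aE sE => [[ga f] s] [[ga' f'] s'] gE aE sE.
  congr (_, _, _); apply/ffunP => x; rewrite ffunE /=.
  - by apply/eqP; have := gE (p.1^-1%g x); rewrite /vgenus /= permKV eq_sym.
  - by apply/eqP; have := aE (p.2^-1%g x); rewrite /attach /= permKV eq_sym.
  - by apply/eqP; have := sE (p.2^-1%g x); rewrite /gluing /= permKV eq_sym.
by split; apply/forallP => x; rewrite /vgenus /attach /gluing /= !ffunE permK.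
Qed.

Lemma isomorphic_orbit G G' :
  isomorphic G G' = (G' \in orbit relabel_action [set: {perm V} * {perm H}]%SET G).
Proof.
apply/existsP/orbitP => [[p]|[p _ pE]].
  by rewrite is_isoE => /eqP pE; exists p; rewrite ?inE.
by exists p; rewrite is_isoE; apply/eqP.
Qed.

Lemma graph_aut_stab G : graph_aut G = ('C[G | relabel_action])%g.
Proof. by apply/setP => p; rewrite !inE finset.sub1set inE is_isoE. Qed.

(** The internal edges are the two-element orbits of the gluing. *)
Lemma card_internal G : involb G.2 ->
  (#|external G| + 2 * #|internal G| = #|H|)%N.
Proof.
move=> /forallP inv.
have invK x : gluing G (gluing G x) = x by apply/eqP/(inv x).
rewrite mulnC -(card_uniform_partition (D := ~: external G)%SET) ?cardsC //.
    move=> A /imsetP [x]; rewrite !inE => nx ->.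
  by rewrite cards2 eq_sym nx.
apply/and3P; split.
- apply/eqP/setP => x; apply/finset.bigcupP/idP => [[A /imsetP [y]]|nx].
    rewrite !inE => ny -> /set2P [] ->; rewrite ?invK ?ny //.
    by rewrite eq_sym ny.
  exists [set x; gluing G x]%SET; last by rewrite !inE eqxx.
  by apply/imsetP; exists x.
- apply/finset.trivIsetP => A B /imsetP [x _ ->] /imsetP [y _ ->]; apply: contraNT.
  case/pred0Pn => z /andP [/set2P zx /set2P zy]; apply/eqP.
  have sw t : [set gluing G t; t]%SET = [set t; gluing G t]%SET by rewrite finset.setUC.
  case: zx zy => -> [] E; rewrite ?E //.
  + by rewrite invK sw.
  + by rewrite -E invK sw.
  + by rewrite -(invK x) E invK.
- apply/imsetP => -[x _ /setP /(_ x)].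
  by rewrite !inE eqxx.
Qed.

Lemma external_relabel G p : #|external (relabel G p)| = #|external G|.
Proof.
rewrite -[RHS](card_imset _ (@perm_inj _ p.2)); apply: eq_card => x.
rewrite -[x](permKV p.2) (mem_imset _ _ (@perm_inj _ p.2)) !inE /gluing /= ffunE.
by rewrite permK (inj_eq perm_inj).
Qed.

Lemma val_at_relabel G p v : val_at (relabel G p) (p.1 v) = val_at G v.
Proof.
rewrite /val_at -[RHS](card_imset _ (@perm_inj _ p.2)); apply: eq_card => x.
rewrite -[x](permKV p.2) (mem_imset _ _ (@perm_inj _ p.2)) !inE /attach /= ffunE.
by rewrite permK (inj_eq perm_inj).
Qed.

Lemma vgenus_relabel G p v : vgenus (relabel G p) (p.1 v) = vgenus G v.
Proof. by rewrite /vgenus /= ffunE permK. Qed.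

Lemma involb_relabel G p : involb G.2 -> involb (relabel G p).2.
Proof.
move=> /forallP inv; apply/forallP => x; rewrite /= !ffunE permK.
by rewrite (eqP (inv _)) permKV.
Qed.

Lemma skconn_relabel G p : involb G.2 ->
  skconn G.1.2 G.2 -> skconn (relabel G p).1.2 (relabel G p).2.
Proof.
move=> inv c; have [v _] := skconn_inh c.
rewrite (skconn_root _ (p.1 v) (involb_relabel p inv)); apply/forallP => w.
rewrite -[w](permKV p.1); move: (p.1^-1%g w) => {}w.
have := c; rewrite (skconn_root _ v inv) => /forallP /(_ w) /connectP [r pr ->].
elim: r v pr => [|z r IHr] v /=; first by rewrite connect0.
case/andP => /existsP [x /andP [/eqP fv /eqP fz]] /IHr; apply: connect_trans.
apply/connect1/existsP; exists (p.2 x).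
by rewrite /= !ffunE !permK fv fz !eqxx.
Qed.

Lemma connected_stable_relabel n G p :
  connected_stable n G -> connected_stable n (relabel G p).
Proof.
case/and5P => inv c st /eqP gE /eqP nE.
have inv' := involb_relabel p inv.
have c' := skconn_relabel p inv c.
have eE := external_relabel G p.
apply/and5P; split=> //.
- apply/forallP => v; rewrite -[v](permKV p.1) vgenus_relabel val_at_relabel.
  by have /forallP := st; apply.
- apply/eqP; rewrite -[RHS]gE /genus /betti1.
  rewrite (eqP c : components G = 1%N) (eqP c' : components (relabel G p) = 1%N).
  congr (_ + 1 - _ + _)%N.
    by have := card_internal inv; have := card_internal inv'; lia.
  rewrite (reindex_inj (@perm_inj _ p.1)); apply: eq_bigr => v _.
  exact: vgenus_relabel.
- by rewrite eE nE.
Qed.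

Lemma graph_sum_labelled n :
  graph_sum g V H n = (((#|V|)`! * (#|H|)`!)%:R)^-1 *
    \sum_(G : graph g V H | connected_stable n G) \prod_v chiM (vgenus G v) (val_at G v).
Proof.
rewrite /graph_sum.
pose F G := \prod_v chiM (vgenus G v) (val_at G v).
have -> : ((#|V|)`! * (#|H|)`!)%N = #|{: {perm V} * {perm H}}|.
  have cperm (T : finType) : #|{perm T}| = (#|T|)`!.
    rewrite -(cardsT T) -card_perm -cardsT -[in RHS]cardsE; apply: eq_card => s.
    by rewrite !inE; apply/esym/fintype.subsetP => x; rewrite !inE.
  by rewrite card_prod !cperm.
transitivity ((#|{: {perm V} * {perm H}}|%:R)^-1 *
    \sum_(G in [set G : graph g V H | connected_stable n G]%SET) F G); last first.
  by congr (_ * _); apply: eq_bigl => G; rewrite inE.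
rewrite -(sum_transversal (to := relabel_action) isomorphic_orbit).
- by apply: eq_bigr => G _; rewrite /graph_weight graph_aut_stab.
- by move=> G p; rewrite !inE; apply: connected_stable_relabel.
- move=> G p; rewrite /F (reindex_inj (@perm_inj _ p.1)); apply: eq_bigr => v _.
  by rewrite vgenus_relabel val_at_relabel.
Qed.

End Relabel.

(** A tree has one edge less than it has vertices: a set of vertices is grown from a
root, and each new vertex comes with an edge that was not yet inside the set. Half-edges
that are not legs are counted, twice the number of edges. *)
Lemma skconn_edges (V H : finType) (f : {ffun H -> V}) (s : {ffun H -> H}) :
  involb s -> skconn f s -> (2 * #|V| <= #|[set x | s x != x]%SET| + 2)%N.
Proof.
move=> inv c; have [v0 _] := skconn_inh c.
have invK x : s (s x) = x by apply/eqP; have /forallP := inv; apply.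
pose ins (S : {set V}) := [set x | [&& s x != x, f x \in S & f (s x) \in S]]%SET.
suff grow k : (0 < k <= #|V|)%N -> exists S : {set V},
    [/\ v0 \in S, #|S| = k & (2 * k <= #|ins S| + 2)%N].
  have [|S [_ _ le]] := grow #|V|; first by rewrite leqnn andbT; apply/card_gt0P; exists v0.
  apply: (leq_trans le); rewrite leq_add2r; apply: subset_leq_card.
  by apply/fintype.subsetP => x; rewrite !inE => /and3P [].
elim: k => [|k IHk] // kV; case: k IHk kV => [|k] IHk kV.
  by exists [set v0]%SET; rewrite inE cards1 !eqxx; split=> //; exact: leq_addl.
have [|S [vS cS le]] := IHk; first by lia.
(* a path from the root to a vertex outside S leaves S through some edge *)
have [x xS sxS] : exists2 x, f x \in S & f (s x) \notin S.
  have [w wS] : exists w, w \notin S.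
    apply/existsP; rewrite -negb_forall; apply/negP => /forallP allS.
    have : (#|V| <= #|S|)%N by apply: subset_leq_card; apply/fintype.subsetP => w _.
    by lia.
  have := c; rewrite (skconn_root _ v0 inv) => /forallP /(_ w) /connectP [r].
  elim: r v0 vS {IHk} => [|z r IHr] v vS /=; first by move=> _ wE; rewrite wE vS in wS.
  case/andP => /existsP [x /andP [/eqP fv /eqP fz]] pr wE.
  have [zS|zS] := boolP (z \in S); first exact: IHr zS pr wE.
  by exists x; rewrite ?fv ?fz.
exists (f (s x) |: S)%SET; rewrite inE vS orbT cardsU1 sxS cS; split=> //.
have xsx : s x != x by apply: contraNneq sxS => ->.
have : ([set x; s x] :|: ins S \subset ins (f (s x) |: S))%SET.
  apply/fintype.subsetP => y; rewrite !inE => /orP [/orP [] /eqP ->|/and3P [-> -> ->]].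
  - by rewrite xsx xS eqxx !orbT.
  - by rewrite invK eq_sym xsx xS eqxx !orbT.
  - by rewrite !orbT.
move/subset_leq_card; rewrite cardsU cards2 eq_sym xsx.
rewrite [X in (_ - X)%N](_ : _ = 0%N); first by lia.
apply: eq_card0 => y; rewrite !inE; apply/negP => /andP [/orP [] /eqP -> /and3P []].
  by rewrite (negbTE sxS).
by rewrite invK (negbTE sxS).
Qed.

(** * Coefficients of the connected sum *)

Section Euler.
Variables (g : nat) (V H : finType).
Implicit Type G : graph g V H.

(** The sum of 2 g_v - 2 + val_v, which is the exponent of q contributed by the
vertices. *)
Definition excess G : nat := (\sum_v (2 * vgenus G v + val_at G v - 2))%N.

Definition stable G : bool := [forall v, (2 < 2 * vgenus G v + val_at G v)%N].

Lemma val_at_sum G : (\sum_v val_at G v = #|H|)%N.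
Proof. exact: (valence_sum G.1.2). Qed.

Lemma excessE G : stable G ->
  (excess G + 2 * #|V| = 2 * \sum_v vgenus G v + #|H|)%N.
Proof.
move=> /forallP st.
rewrite -(val_at_sum G) big_distrr -big_split /= mulnC -sum_nat_const -big_split /=.
by apply: eq_bigr => v _; have := st v; lia.
Qed.

(** 2g - 2 + n is additive over the vertices. Connectedness is what makes the
truncated subtraction in the first Betti number exact. *)
Lemma euler G : involb G.2 -> components G == 1%N -> stable G ->
  (2 * genus G + #|external G| = excess G + 2)%N.
Proof.
move=> inv c st; have xE := excessE st.
have cI := card_internal inv; have := skconn_edges inv c.
have -> : #|[set x | G.2 x != x]%SET| = (#|H| - #|external G|)%N.
  rewrite -(cardsC (external G)) addKn; apply: eq_card => x.
  by rewrite !inE.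
rewrite /genus /betti1 (eqP c); lia.
Qed.

(** With Euler's formula, this leaves finitely many stable graphs of a given genus
with a given number of legs. *)
Lemma excess_bounds G : stable G ->
  (#|V| <= excess G /\ #|H| <= 3 * excess G)%N.
Proof.
move=> /forallP st; split.
  by rewrite -sum1_card; apply: leq_sum => v _; have := st v; lia.
rewrite -(val_at_sum G) big_distrr /=; apply: leq_sum => v _; have := st v; lia.
Qed.

End Euler.

Section Coefficients.
Variable N : nat.

Definition vertex_poly (n : nat) : {poly {poly rat}} :=
  \sum_(g < N.+1 | (2 < 2 * g + n)%N) (chiM g n)%:P *: 'X^(2 * g + n - 2).

(** The exponent of the Gaussian integral has no term in x^0, hence no vertex of
valence 0. *)
Definition vertex_poly_pos (n : nat) : {poly {poly rat}} :=
  if n == 0%N then 0 else vertex_poly n.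

Definition leg_poly : {poly {poly rat}} := ('X : {poly rat}) *: 'X.

Lemma vertex_poly_ord n : ordX (maxn 1 (n - 2)) (vertex_poly n).
Proof.
apply: ordX_sum => g st; apply: ordXZ => i ilt.
by rewrite coefXn coef0; case: eqP => // ie; lia.
Qed.

Lemma vertex_poly_pos_ord n : ordX (maxn 1 (n - 2)) (vertex_poly_pos n).
Proof.
rewrite /vertex_poly_pos; case: eqP => _; [exact: ordX_zero | exact: vertex_poly_ord].
Qed.

Lemma leg_poly_ord : ordX 1 leg_poly.
Proof. by move=> [|//] _; rewrite coefZ coefX mulr0 coef0. Qed.

Definition chi_weight g (V H : finType) (G : graph g V H) : rat :=
  \prod_v chiM (vgenus G v) (val_at G v).

(** Expanding the product of the vertex series distributes genera over the
vertices. *)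
Lemma conn_sum_coef (V H : finType) i k :
  (conn_sum (wphi vertex_poly leg_poly) V H)`_i`_k =
  \sum_(G : graph N V H | [&& involb G.2, components G == 1%N, stable G,
      i == (excess G + #|external G|)%N & #|external G| == k]) chi_weight G.
Proof.
transitivity (\sum_(ga : {ffun V -> 'I_N.+1}) \sum_(f : {ffun H -> V})
    \sum_(s : {ffun H -> H} | let G : graph N V H := (ga, f, s) in
      [&& involb G.2, components G == 1%N, stable G,
      i == (excess G + #|external G|)%N & #|external G| == k])
      chi_weight ((ga, f, s) : graph N V H)); last first.
  rewrite pair_big /= pair_big_dep /=.
  by apply: eq_big => [[[ga f] s]|[[ga f] s]].
rewrite exchange_big /conn_sum !coef_sum; apply: eq_bigr => f _ /=.
rewrite (exchange_big_dep (fun s => involb s && skconn f s)) /=; last first.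
  by move=> ga s _ /and5P [-> c _ _ _]; rewrite andTb; apply: c.
rewrite !coef_sum; apply: eq_bigr => s /andP [inv c].
rewrite weight_wphi (bigA_distr_big_dep (fun v (j : 'I_N.+1) => (2 < 2 * j + valence f v)%N)) /=.
rewrite big_distrl /= !coef_sum /= [RHS]big_mkcond [LHS]big_mkcond; apply: eq_bigr => ga _.
rewrite inv -[components _]/(n_comp (skadj f s) predT) -/(skconn f s) c !andTb.
rewrite -[(ga \in _)]/(stable ((ga, f, s) : graph N V H)).
case: (stable _) => //=.
rewrite scaler_prod -(rmorph_prod polyC) prodrXr -/(chi_weight ((ga, f, s) : graph N V H)).
rewrite -/(excess ((ga, f, s) : graph N V H)) -[fixpoints s]/#|external ((ga, f, s) : graph N V H)|.
set e := excess _; set m := #|_|; rewrite exprZn -scalerAl -scalerAr -exprD.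
rewrite !coefZ coefXn mul_polyC coefZ; case: (i == _); last by rewrite mulr0 coef0 mulr0.
by rewrite mulr1 coefXn eq_sym; case: (m == k); rewrite ?mulr1 ?mulr0.
Qed.

Definition widen_genus g (gN : (g <= N)%N) (V H : finType) (G : graph g V H) : graph N V H :=
  ([ffun v => widen_ord (n := g.+1) (m := N.+1) gN (G.1.1 v)], G.1.2, G.2).

Lemma vgenus_widen g (gN : (g <= N)%N) (V H : finType) (G : graph g V H) v :
  vgenus (widen_genus gN G) v = vgenus G v.
Proof. by rewrite /vgenus /= ffunE. Qed.

(** By Euler's formula the exponents of q and u fix the genus, which bounds the
genera of the vertices; this reconciles the two ranges of vertex genera. *)
Lemma conn_sum_graphs (V H : finType) g i k :
  (2 * g + 2 * k = i + 2)%N -> (g <= N)%N ->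
  (conn_sum (wphi vertex_poly leg_poly) V H)`_i`_k =
  \sum_(G : graph g V H | connected_stable k G) chi_weight G.
Proof.
move=> gki gN; rewrite conn_sum_coef.
pose narrow (G : graph N V H) : graph g V H :=
  ([ffun v => inord (G.1.1 v)], G.1.2, G.2).
rewrite (reindex_onto (widen_genus gN (H := H)) narrow) /=; last first.
  case=> [[ga f] s] /and5P [inv c st /eqP iE /eqP kE].
  congr (_, _, _); apply/ffunP => v; apply: val_inj; rewrite !ffunE /= inordK //.
  have e := euler inv c st.
  have : (vgenus ((ga, f, s) : graph N V H) v <= genus ((ga, f, s) : graph N V H))%N.
    by rewrite /genus (bigD1 v) //= addnCA leq_addr.
  by rewrite /vgenus /= ltnS => vg; apply: (leq_trans vg); lia.
have wE (G : graph g V H) : chi_weight (widen_genus gN G) = chi_weight G.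
  by apply: eq_bigr => v _; rewrite vgenus_widen.
have sE (G : graph g V H) : stable (widen_genus gN G) = stable G.
  by apply: eq_forallb => v; rewrite vgenus_widen.
have xE (G : graph g V H) : excess (widen_genus gN G) = excess G.
  by apply: eq_bigr => v _; rewrite vgenus_widen.
apply: eq_big => [G|G _]; last exact: wE.
rewrite sE xE /connected_stable -/(involb G.2) -/(stable G).
have -> : narrow (widen_genus gN G) == G.
  case: G => [[ga f] s]; apply/eqP; congr (_, _, _); apply/ffunP => v.
  by apply: val_inj; rewrite !ffunE /= inordK.
rewrite andbT; case inv: (involb G.2) => //=.
rewrite -[components (widen_genus gN G)]/(components G).
case c: (components G == 1%N) => //=; case st: (stable G) => //=.
have e := euler inv c st.
rewrite -[#|external (widen_genus gN G)|]/#|external G|.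
case: (#|external G| =P k) => [kE|_]; rewrite ?andbF // !andbT.
by apply/eqP/eqP; lia.
Qed.

Lemma conn_sum_no_genus (V H : finType) i k :
  (forall g, (2 < 2 * g + k)%N -> (2 * g + 2 * k)%N <> (i + 2)%N) ->
  (conn_sum (wphi vertex_poly leg_poly) V H)`_i`_k = 0.
Proof.
move=> ng; rewrite conn_sum_coef big_pred0 // => G.
apply/negP => /and5P [inv c st /eqP iE /eqP kE].
have e := euler inv c st; have [le _] := excess_bounds st.
have [v _] := skconn_inh c.
have V0 : (0 < #|V|)%N by apply/card_gt0P; exists v.
by apply: (ng (genus G)); lia.
Qed.

(** A vertex without half-edges is a component on its own. *)
Lemma skconn_valence0 (V H : finType) (f : {ffun H -> V}) s v :
  involb s -> skconn f s -> valence f v = 0%N -> #|V| = 1%N /\ #|H| = 0%N.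
Proof.
move=> inv c v0.
have only w : w = v.
  have := c; rewrite (skconn_root _ v inv) => /forallP /(_ w) /connectP [[|z r] /=].
    by move=> _ ->.
  case/andP => /existsP [x /andP [fv _]]; have : x \in [set x | f x == v]%SET by rewrite inE.
  by rewrite (card0_eq v0).
split; first by apply/eqP/fintype1P; exists v.
by rewrite -(valence_sum f) big1 // => w _; rewrite (only w).
Qed.

Lemma conn_egf_pos l a : (l, a) != (1%N, 0%N) ->
  conn_egf (wphi vertex_poly_pos leg_poly) l a = conn_egf (wphi vertex_poly leg_poly) l a.
Proof.
move=> la; rewrite /conn_egf; congr (_ *: _); apply: eq_bigr => f _; apply: eq_bigr => s.
case/andP => inv c; rewrite !weight_wphi; congr (_ * _); apply: eq_bigr => v _.
rewrite /vertex_poly_pos; case: eqP => // /(skconn_valence0 inv c).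
by rewrite !card_ord => -[l1 a0]; rewrite l1 a0 eqxx in la.
Qed.

(** The only graph here is a single vertex without half-edges. *)
Lemma conn_egf10 W U : conn_egf (wphi W U) 1 0 = W 0%N.
Proof.
rewrite /conn_egf /inv_labellings /= !fact0 invr1 scale1r /conn_sum.
have f0 (T : Type) (f f' : 'I_0 -> T) : f =1 f' by case.
have fE (f f' : {ffun 'I_0 -> 'I_1}) : f = f' by apply/ffunP; case.
have sE (s s' : {ffun 'I_0 -> 'I_0}) : s = s' by apply/ffunP; case.
pose f1 : {ffun 'I_0 -> 'I_1} := [ffun=> ord0].
pose s1 : {ffun 'I_0 -> 'I_0} := [ffun x => x].
rewrite (big_pred1 f1); last by move=> f; apply/esym/eqP/fE.
have inv : involb s1 by apply/forallP; case.
rewrite (big_pred1 s1); last first.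
  move=> s; rewrite [RHS](_ : _ = true); last exact/eqP/sE.
  rewrite (sE s s1) inv (skconn_root _ ord0 inv); apply/forallP => w.
  by rewrite [w]ord1 connect0.
rewrite weight_wphi big_ord1 /valence /fixpoints.
by rewrite !eq_card0 ?expr0 ?mulr1 // => -[].
Qed.

Lemma Cpoly_pos :
  Cpoly N vertex_poly leg_poly = Cpoly N vertex_poly_pos leg_poly + vertex_poly 0.
Proof.
rewrite /Cpoly.
pose X a := \sum_(l < (3 * N).+1) (conn_egf (wphi vertex_poly leg_poly) l a
   - conn_egf (wphi vertex_poly_pos leg_poly) l a).
apply/eqP; rewrite addrC -subr_eq -sumrB (eq_bigr (fun a : 'I_(3 * N).+1 => X a));
  last by move=> a _; rewrite /X sumrB.
rewrite big_ord_recl big1 ?addr0 => [|a _]; last first.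
  by rewrite /X big1 // => l _; rewrite conn_egf_pos ?subrr // xpair_eqE andbF.
(* for N = 0 the truncation leaves out the graph with one vertex, and the vertex
   series of valence 0 is empty *)
have [N0|N0] := posnP N.
  have -> : vertex_poly 0 = 0.
    by rewrite /vertex_poly big_pred0 // => -[g /= gN]; lia.
  rewrite /X big1 // => -[l /= lN] _; rewrite conn_egf_pos ?subrr // xpair_eqE.
  by rewrite (_ : (l == 1)%N = false) //; lia.
have l1 : (1 < (3 * N).+1)%N by lia.
rewrite /X (bigD1 (Ordinal l1)) //= !conn_egf10 subr0 big1 ?addr0 // => l.
by rewrite -val_eqE /= => nl; rewrite conn_egf_pos ?subrr // xpair_eqE (negbTE nl).
Qed.

End Coefficients.

(** * Series as truncated polynomials *)

(** A sum over a set that is finitely supported for a visible reason: its nonzero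
terms lie in the image of a finite type. *)
Lemma fsum_image (M : choiceType) (I : finType) (e : I -> M) (A : set M) (F : M -> rat) :
  injective e -> (forall x, A x -> F x != 0 -> exists i, x = e i) ->
  \sum_(x \in A) F x = \sum_(i | e i \in A) F (e i).
Proof.
move=> e_inj eA; pose r := [seq e i | i <- enum I & e i \in A].
rewrite (@fsbigE _ _ _ _ A r).
- rewrite big_map big_filter_cond big_enum_cond /=.
  by apply: eq_bigl => i; rewrite andbb.
- by rewrite map_inj_uniq // filter_uniq // enum_uniq.
- by move=> x /= /mapP [i]; rewrite mem_filter => /andP [/set_mem eiA _] ->.
move=> x Ax; apply: contraNeq => Fx0; have [i xE] := eA x Ax Fx0.
by rewrite xE; apply: map_f; rewrite mem_filter mem_enum -xE mem_set.
Qed.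

(** The exponent of y^k z^(2k - i), which is u^k q^i in the variables given by z = 1/q
and y = u q^2. *)
Definition pos (k i : nat) : int * int := (k%:Z, (2 * k)%:Z - i%:Z).

Definition in_cone (m : int * int) : bool := (0 <= m.1) && (0 <= 2 * m.1 - m.2).

Lemma in_coneP m : in_cone m -> exists k i, m = pos k i.
Proof.
case: m => a b; rewrite /in_cone /= => /andP [a0 b0]; exists `|a|%N, `|(2 * a - b)%R|%N.
by congr (_, _); lia.
Qed.

Lemma pos_inj k i k' i' : pos k i = pos k' i' -> k = k' /\ i = i'.
Proof. by case=> kE; rewrite kE => iE; split; lia. Qed.

Lemma in_cone_pos k i : in_cone (pos k i).
Proof. by rewrite /in_cone /=; lia. Qed.

Definition cone (f : yz_series) : Prop := forall m, f m != 0 -> in_cone m.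

Lemma in_coneB m e : in_cone e -> in_cone (m - e) -> in_cone m.
Proof. by case: m e => [a b] [c d]; rewrite /in_cone /=; lia. Qed.

Lemma series_mul_neq0 (M : zmodType) (f h : M -> rat) m :
  series_mul f h m != 0 -> exists2 e, f e != 0 & h (m - e) != 0.
Proof.
move=> nz; apply: contrapT => none; case/eqP: nz; apply: fsbig1 => e _.
apply/eqP; rewrite mulf_eq0 -[_ || _]negbK negb_or; apply/negP => /andP [fe he].
by apply: none; exists e.
Qed.

Lemma cone_mul f h : cone f -> cone h -> cone (series_mul f h).
Proof.
by move=> cf ch m /series_mul_neq0 [e /cf ce /ch]; apply: in_coneB.
Qed.

Lemma posB k i (k' : 'I_k.+1) (i' : 'I_i.+1) :
  pos k i - pos k' i' = pos (k - k') (i - i').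
Proof.
case: k' i' => [k' kk] [i' ii]; congr (_, _) => /=; lia.
Qed.

Lemma in_cone_sub k i e : in_cone e -> in_cone (pos k i - e) ->
  exists (k' : 'I_k.+1) (i' : 'I_i.+1), e = pos k' i'.
Proof.
move=> /in_coneP [k' [i' ->]]; rewrite /in_cone => /andP [kk ii]; move: kk ii => /= kk ii.
have kk' : (k' < k.+1)%N by lia.
have ii' : (i' < i.+1)%N by lia.
by exists (Ordinal kk'), (Ordinal ii').
Qed.

Lemma series_mul_pos (f h : yz_series) k i : cone f -> cone h ->
  series_mul f h (pos k i) =
  \sum_(i' < i.+1) \sum_(k' < k.+1) f (pos k' i') * h (pos (k - k') (i - i')).
Proof.
move=> cf ch.
rewrite /series_mul (@fsum_image _ ('I_i.+1 * 'I_k.+1)%type (fun x => pos x.2 x.1)).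
- rewrite pair_big /=; apply: eq_big => [x|[i' k'] _ /=]; first by rewrite in_setT.
  by rewrite posB.
- by move=> [i1 k1] [i2 k2] /pos_inj /= [/val_inj -> /val_inj ->].
move=> e _; rewrite mulf_eq0 negb_or => /andP [/cf ce /ch cme].
by have [k' [i' ->]] := in_cone_sub ce cme; exists (i', k').
Qed.

(** The support condition is on all exponents, not only on those of degree at most N
in q: it makes every product of such series a finite sum in each coefficient. *)
Definition represents (N : nat) (f : yz_series) (p : {poly {poly rat}}) : Prop :=
  cone f /\ forall i k, (i <= N)%N -> f (pos k i) = p`_i`_k.

Section Represents.
Variable N : nat.

Lemma rep_ext f f' p : f =1 f' -> represents N f p -> represents N f' p.
Proof.
by move=> E [cf vf]; split=> [m|i k iN]; rewrite -E; [apply: cf | apply: vf].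
Qed.

Lemma rep_eqm f p p' : eqm N.+1 p p' -> represents N f p -> represents N f p'.
Proof. by move=> E [cf vf]; split=> // i k iN; rewrite vf // E. Qed.

Lemma rep_zero : represents N (fun _ => 0) 0.
Proof. by split=> [m|i k _]; rewrite ?eqxx // !coef0. Qed.

Lemma rep_mul f h p q :
  represents N f p -> represents N h q -> represents N (series_mul f h) (p * q).
Proof.
move=> [cf vf] [ch vh]; split=> [|i k iN]; first exact: cone_mul.
rewrite series_mul_pos // coefM coef_sum; apply: eq_bigr => -[i' /= ii] _.
rewrite coefM; apply: eq_bigr => -[k' /= kk] _.
by rewrite vf ?vh //; lia.
Qed.

Lemma rep_scale c f p : represents N f p -> represents N (c \*o f) (c%:P *: p).
Proof.
move=> [cf vf]; split=> [m|i k iN] /=.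
  by rewrite mulf_eq0 negb_or => /andP [_ /cf].
by rewrite vf // coefZ mul_polyC coefZ.
Qed.

Lemma rep_add f h p q :
  represents N f p -> represents N h q -> represents N (f \+ h) (p + q).
Proof.
move=> [cf vf] [ch vh]; split=> [m|i k iN] /=; last by rewrite vf // vh // !coefD.
have [->|/cf //] := eqVneq (f m) 0; by rewrite add0r => /ch.
Qed.

Lemma rep_sub f h p q :
  represents N f p -> represents N h q -> represents N (f \- h) (p - q).
Proof.
move=> [cf vf] [ch vh]; split=> [m|i k iN] /=; last by rewrite vf // vh // !coefB.
have [->|/cf //] := eqVneq (f m) 0; by rewrite sub0r oppr_eq0 => /ch.
Qed.

Lemma rep_monomial k i : represents N (monomial (pos k i)) ('X^k *: 'X^i).
Proof.
split=> [m|i' k' _]; rewrite /monomial.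
  by case: (m =P pos k i) => [-> _|_]; [apply: in_cone_pos | rewrite eqxx].
rewrite coefZ coefXn; case: (i' =P i) => [->|ne].
  rewrite mulr1 coefXn; congr (_%:R); congr nat_of_bool.
  by apply/eqP/eqP => [/pos_inj [->]|->].
by rewrite mulr0 coef0; case: eqP => // /pos_inj [_ /ne].
Qed.

Lemma rep_one : represents N (monomial 0) 1.
Proof. by have := rep_monomial 0 0; rewrite !expr0 scale1r. Qed.

Lemma rep_pow f p n : represents N f p -> represents N (series_pow f n) (p ^+ n).
Proof.
move=> rf; elim: n => [|n IHn]; first exact: rep_one.
by rewrite exprS; apply: rep_mul.
Qed.

Lemma cone_sum (I : choiceType) (A : set I) (F : I -> yz_series) :
  (forall i, A i -> cone (F i)) -> cone (series_sum A F).
Proof.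
move=> cF m nz; apply: contrapT => nm; case/eqP: nz; apply: fsbig1 => i Ai.
by apply/eqP; apply: contrapT => /negP /(cF i Ai).
Qed.

Lemma rep_log f (z : {poly {poly rat}}) : z`_0 = 1 -> represents N f z ->
  represents N (series_log f) (log_trunc N z).
Proof.
move=> z0 rf.
have rp k := rep_pow k (rep_sub rf rep_one).
split=> [|i k iN].
  by apply: cone_sum => j _; have [] := rep_scale ((-1) ^+ j.-1 / j%:R) (rp j).
rewrite /series_log /series_sum.
rewrite (@fsum_image _ 'I_N (fun j => j.+1)) => [|x y [/val_inj] //|j /= j0].
  rewrite /log_trunc !coef_sum; apply: eq_big => [j|j _].
    by rewrite mem_set.
  by have [_ ->] := rep_scale ((-1) ^+ j / j.+1%:R) (rp j.+1).
have [_ /(_ i k iN) /= ->] := rep_scale ((-1) ^+ j.-1 / j%:R) (rp j).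
have [jN _|Nj] := leqP j N.
  have jN' : (j.-1 < N)%N by lia.
  by exists (Ordinal jN') => /=; lia.
have z1 : ordX 1 (z - 1) by move=> [|//] _; rewrite coefB coef1 z0 subrr coef0.
have := @ordX_exp _ 1 (z - 1) j z1; rewrite muln1 coefZ => ->; last by lia.
by rewrite coef0 mulr0 coef0 eqxx.
Qed.

End Represents.

Section RepresentsX.
Variable N : nat.

Definition xslice (F : int * (int * int) -> rat) (j : nat) : yz_series :=
  fun m => F (j%:Z, m).

(** Series that also involve x are compared coefficient by coefficient in x; the
polynomial in x is exact, not truncated. *)
Definition represents_x (F : int * (int * int) -> rat)
    (P : {poly {poly {poly rat}}}) : Prop :=
  (forall e, F e != 0 -> 0 <= e.1) /\ forall j, represents N (xslice F j) P`_j.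

Lemma repx_one : represents_x (monomial 0) 1.
Proof.
split=> [[j m]|j]; rewrite /monomial.
  by case: ((j, m) =P 0) => [[-> _] //|_]; rewrite eqxx.
rewrite coef1; case: j => [|j].
  by apply: (rep_ext _ (rep_one N)) => m; rewrite /xslice /monomial.
by apply: (rep_ext _ (rep_zero N)) => m; rewrite /xslice.
Qed.

Lemma xslice_neq0 F P e : represents_x F P -> F e != 0 ->
  exists j : nat, e.1 = j%:Z /\ in_cone e.2.
Proof.
case: e => [j m] [Fx Fs] nz; have /= j0 := Fx _ nz.
exists `|j|%N; have jE : j = `|j|%N%:Z by lia.
by split=> //; have [c _] := Fs `|j|%N; apply: c; rewrite /xslice -jE.
Qed.

Lemma repx_mul F G P Q : represents_x F P -> represents_x G Q ->
  represents_x (series_mul F G) (P * Q).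
Proof.
move=> rF rG; have [_ sF] := rF; have [_ sG] := rG.
have nz j m : series_mul F G (j, m) != 0 -> 0 <= j /\ in_cone m.
  case/series_mul_neq0 => -[i e] /(xslice_neq0 rF) /= [i' [-> ce]].
  case/(xslice_neq0 rG) => j' /= [jE cme]; split; last exact: in_coneB cme.
  by have := jE => /=; lia.
split=> [[j m] /nz [] //|j].
split=> [m /nz [] //|i k iN]; rewrite coefM !coef_sum.
transitivity (\sum_(j' < j.+1) series_mul (xslice F j') (xslice G (j - j')) (pos k i));
  last by apply: eq_bigr => j' _; have [_ ->] := rep_mul (sF j') (sG (j - j')%N).
rewrite /xslice /series_mul.
rewrite (@fsum_image _ ('I_j.+1 * ('I_i.+1 * 'I_k.+1))%type
  (fun x => ((x.1 : nat)%:Z, pos x.2.2 x.2.1))).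
- transitivity (\sum_(x : 'I_j.+1 * ('I_i.+1 * 'I_k.+1))
     F ((x.1 : nat)%:Z, pos x.2.2 x.2.1) *
     G ((j - x.1)%N%:Z, pos (k - x.2.2) (i - x.2.1))).
    apply: eq_big => [x|[j' [i' k']] _ /=]; first by rewrite in_setT.
    rewrite -posB; congr (_ * G (_, _)).
    by case: j' => /= j' jj; rewrite subzn.
  rewrite -(pair_bigA _ (fun (x1 : 'I_j.+1) (x2 : 'I_i.+1 * 'I_k.+1) =>
     F ((x1 : nat)%:Z, pos x2.2 x2.1) * G ((j - x1)%N%:Z, pos (k - x2.2) (i - x2.1)))) /=.
  apply: eq_bigr => j' _.
  rewrite -/(series_mul (xslice F j') (xslice G (j - j')) (pos k i)).
  rewrite series_mul_pos; [|by have [] := sF j'|by have [] := sG (j - j')%N].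
  by rewrite pair_bigA.
- move=> [j1 [i1 k1]] [j2 [i2 k2]] /= [/val_inj -> /val_inj -> iE].
  by congr (_, (_, _)); apply: val_inj => /=; lia.
move=> [j1 e] _; rewrite mulf_eq0 negb_or => /andP [/(xslice_neq0 rF) /= [a [-> ce]]].
case/(xslice_neq0 rG) => b /= [jE cme].
have [k' [i' ->]] := in_cone_sub ce cme.
have ja : (a < j.+1)%N by move: jE => /=; lia.
by exists (Ordinal ja, (i', k')).
Qed.

Lemma repx_pow F P n : represents_x F P -> represents_x (series_pow F n) (P ^+ n).
Proof.
move=> rF; elim: n => [|n IHn]; first exact: repx_one.
by rewrite exprS; apply: repx_mul.
Qed.

(** P has no constant term in x, so that only the powers below K reach x^j. *)
Lemma repx_exp F (P : {poly {poly {poly rat}}}) j K : P`_0 = 0 -> represents_x F P -> (j < K)%N ->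
  represents N (xslice (series_exp F) j)
    (\sum_(l < K) (l`!%:R^-1)%:P *: (P ^+ l)`_j).
Proof.
move=> P0 rF jK.
have rs l : represents N (xslice ((l`!%:R)^-1 \*o series_pow F l) j)
    ((l`!%:R^-1)%:P *: (P ^+ l)`_j).
  by have [_ /(_ j)] := repx_pow l rF; apply: rep_scale.
split=> [|i k iN].
  apply: (@cone_sum _ _ (fun l => xslice ((l`!%:R)^-1 \*o series_pow F l) j)) => l _.
  by have [] := rs l.
rewrite /xslice /series_exp /series_sum (@fsum_image _ 'I_K (fun l => l : nat)).
- rewrite !coef_sum; apply: eq_big => [l|l _]; first by rewrite in_setT.
  by have [_ <-] := rs l.
- exact: val_inj.
move=> l _; have [_ /(_ i k iN)] := rs l; rewrite /xslice /= => ->.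
have [lK _|Kl] := ltnP l K; first by exists (Ordinal lK).
have P1 : ordX 1 P by move=> [|//] _; rewrite P0 coef0.
have := @ordX_exp _ 1 P l P1; rewrite muln1 => -> //; last by lia.
by rewrite coef0 scaler0 !coef0 eqxx.
Qed.

End RepresentsX.

(** * The partition function in the variables q and u *)

Section Assembly.
Variable N : nat.

Lemma rep_V_vertex gmin n : (forall g, (gmin <= g)%N = (2 < 2 * g + n)%N) ->
  represents N (V_vertex gmin n) (vertex_poly N n).
Proof.
move=> gE.
have rg g : (gmin <= g)%N -> represents N (chiM g n \*o yz 0 (2 - 2 * g%:Z - n%:Z))
    ((chiM g n)%:P *: 'X^(2 * g + n - 2)).
  rewrite gE => st; apply: rep_scale.
  have := rep_monomial N 0 (2 * g + n - 2); rewrite expr0 scale1r.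
  by apply: rep_ext => m; rewrite /yz; congr (monomial (_, _) m); lia.
split=> [|i k iN]; first by apply: cone_sum => g /rg [].
rewrite /V_vertex /series_sum (@fsum_image _ 'I_N.+1 (fun g => g : nat)).
- rewrite /vertex_poly !coef_sum; apply: eq_big => [g|g /set_mem /rg [_ ->] //].
  by rewrite -gE; apply/idP/idP => [/set_mem|/mem_set].
- exact: val_inj.
move=> g gA; have [_ /(_ i k iN) /= ->] := rg g gA.
rewrite coefZ coefXn; case: (i =P _) => [iE _|_]; last by rewrite mulr0 coef0 eqxx.
have gN : (g < N.+1)%N by move: gA; rewrite /= gE; lia.
by exists (Ordinal gN).
Qed.

Lemma rep_leg : represents N (yz 1 1) leg_poly.
Proof. exact: (rep_monomial N 1 1). Qed.

Lemma rep_leg2 : represents N (yz 2 2) (leg_poly ^+ 2).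
Proof. by have := rep_monomial N 2 2; rewrite /leg_poly exprZn. Qed.

Lemma rep_Vtilde0 :
  represents N (Vtilde 0) ((- 2^-1)%:P *: leg_poly ^+ 2 + vertex_poly N 0).
Proof.
apply: rep_add; first exact/rep_scale/rep_leg2.
by apply: rep_V_vertex => g; lia.
Qed.

Lemma rep_Vtilde n : (0 < n)%N ->
  represents N (Vtilde n) (vertex_poly_pos N n + leg_poly *+ (n == 1)%N).
Proof.
rewrite /vertex_poly_pos; case: n => [|[|[|n]]] //= _; rewrite ?mulr0n ?addr0.
- rewrite addrC; apply: rep_add; first exact: rep_leg.
  by apply: rep_V_vertex => g; lia.
- by apply: rep_V_vertex => g; lia.
- by apply: rep_V_vertex => g; lia.
Qed.

(** The times t_n = (n + 1)! T_(n + 1) for T_n = V_n / n!, kept in the form that they take in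
the partition function. *)
Definition times (n : nat) : yz_series :=
  n.+1`!%:R \*o ((n.+1`!%:R)^-1 \*o Vtilde n.+1).

Lemma timesE n : times n =1 Vtilde n.+1.
Proof.
move=> m; rewrite -[LHS]/(n.+1`!%:R * ((n.+1`!%:R)^-1 * Vtilde n.+1 m)).
by rewrite mulrA divff ?mul1r // pnatr_eq0 -lt0n fact_gt0.
Qed.

Lemma action1D_slice j m : action1D times (j%:Z, m) =
  if j == 0%N then 0 else (j`!%:R)^-1 * Vtilde j m.
Proof.
rewrite /action1D /series_sum (@fsum_image _ unit (fun _ => j)).
- rewrite (eq_bigl (fun _ => 0 < j)%N); last first.
    by move=> x; apply/idP/idP => [/set_mem|/mem_set].
  case: j => [|j]; first by rewrite big_pred0_eq.
  rewrite (big_pred1 tt); last by case.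
  rewrite -[LHS]/((j.+1`!%:R)^-1 * ((j.+1%:Z == j.+1%:Z)%:R * times j m)).
  by rewrite timesE eqxx mul1r.
- by move=> [] [].
move=> n _ /=; rewrite /times_xpow /=; case: (j%:Z =P n%:Z) => [[->] _|_].
  by exists tt.
by rewrite mul0r mulr0 eqxx.
Qed.

Lemma action1D_neg j m : action1D times (j, m) != 0 -> 0 <= j.
Proof.
move=> nz; apply: contrapT => jneg; case/eqP: nz; apply: fsbig1 => n _ /=.
rewrite /times_xpow /=; case: (j =P n%:Z) => [jE|_]; last by rewrite mul0r mulr0.
by case: jneg; rewrite jE.
Qed.

Definition action_poly : {poly {poly {poly rat}}} :=
  act N (vertex_poly_pos N) leg_poly.

Lemma repx_action : represents_x N (action1D times) action_poly.
Proof.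
split=> [[j m]|j]; first exact: action1D_neg.
apply: (rep_ext (fun m => esym (action1D_slice j m))).
rewrite /action_poly /act coefD coefZ coefX coef_poly.
have [->|j0] /= := eqVneq j 0%N.
  rewrite mulr0 addr0 /vertex_poly_pos scaler0; exact: rep_zero.
have jpos : (0 < j)%N by rewrite lt0n.
apply: (rep_eqm _ (rep_scale ((j`!%:R)^-1) (rep_Vtilde jpos))).
rewrite scalerDr; apply: eqmD.
  case: ltnP => // Lj; apply: ordXZ; apply: ordX_le (@vertex_poly_pos_ord N j).
  by lia.
case: eqP => [->|_]; last by rewrite mulr0 scaler0.
by rewrite factS fact0 mul1n invr1 scale1r mulr1.
Qed.

(** Each x comes with at least a third of a q, also for the source term Ux. *)
Lemma action_poly_ord l j : ordX ((j + 2) %/ 3) ((action_poly ^+ l)`_j).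
Proof.
elim: l j => [|l IHl] j.
  by rewrite expr0 coef1; case: j => [|j]; [apply: ordX_0 | apply: ordX_zero].
rewrite exprS coefM; apply: ordX_sum => -[i /= ij] _.
apply: ordX_le (ordXM (M := (i + 2) %/ 3) _ (IHl _)); first by lia.
rewrite /action_poly /act coefD coefZ coefX coef_poly => e elt.
rewrite coefD coef0; have -> : (leg_poly * (i == 1%N)%:R)`_e = 0.
  case: eqP => [i1|_]; last by rewrite mulr0 coef0.
  by rewrite mulr1 leg_poly_ord ?coef0 //; lia.
rewrite addr0; case: ifP => _; last by rewrite coef0.
have o := @vertex_poly_pos_ord N i.
by rewrite coefZ o ?coef0 ?mulr0 //; lia.
Qed.

Lemma rep_Z : represents N (Z1D times) (Zpoly N (vertex_poly_pos N) leg_poly).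
Proof.
have P0 : action_poly`_0 = 0.
  by rewrite /action_poly /act coefD coefZ coefX mulr0 addr0 coef_poly /= scaler0.
have rs j K : (j < K)%N -> represents N
    (fun e => gauss_moment j * series_exp (action1D times) (j%:Z, e))
    ((gauss_moment j)%:P *: \sum_(l < K) (l`!%:R^-1)%:P *: (action_poly ^+ l)`_j).
  by move=> jK; apply: rep_scale; apply: (repx_exp P0 repx_action jK).
split=> [|i k iN]; first by apply: cone_sum => j _; have [] := rs j j.+1 (ltnSn j).
rewrite /Z1D /series_sum (@fsum_image _ 'I_(3 * N).+1 (fun j => j : nat)).
- rewrite /Zpoly !coef_sum; apply: eq_big => [j|j _]; first by rewrite in_setT.
  have [_ ->//] := rs j _ (ltn_ord j).
  rewrite /exp_trunc coef_sum; congr ((_ *: (_ : {poly {poly rat}}) : {poly {poly rat}})`_i`_k).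
  apply: eq_bigr => l _.
  by rewrite coefZ mul_polyC.
- exact: val_inj.
(* the coefficients of x^j for j > 3N are multiples of q^(N+1) *)
move=> j _; have [_ /(_ i k iN) /= ->] := rs j j.+1 (ltnSn j).
have [jL _|Lj] := ltnP j (3 * N).+1; first by exists (Ordinal jL).
rewrite coefZ coef_sum big1 => [|l _]; first by rewrite mulr0 coef0 eqxx.
by rewrite coefZ (@action_poly_ord l j) ?coef0 ?mulr0 //; lia.
Qed.

(** All the graphs with the given genus and number of legs have at most 3N vertices
and at most 3N half-edges. *)
Lemma chiMbar_box i k g : (i <= N)%N -> (2 * g + 2 * k = i + 2)%N -> (2 < 2 * g + k)%N ->
  chiMbar g k / k`!%:R = (Cpoly N (vertex_poly N) leg_poly)`_i`_k.
Proof.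
move=> iN gki st; have gN : (g <= N)%N by lia.
rewrite /chiMbar mulrAC divff ?mul1r; last by rewrite pnatr_eq0 -lt0n fact_gt0.
have gs l a : (conn_egf (wphi (vertex_poly N) leg_poly) l a)`_i`_k
    = graph_sum g 'I_l 'I_a k.
  rewrite graph_sum_labelled !card_ord /conn_egf coefZ mul_polyC coefZ.
  by rewrite (conn_sum_graphs _ _ gki gN).
rewrite (@fsum_image _ ('I_(3 * N).+1 * 'I_(3 * N).+1)%type
  (fun x => (x.2 : nat, x.1 : nat))).
- rewrite /Cpoly !coef_sum.
  under [RHS]eq_bigr do rewrite !coef_sum.
  rewrite pair_big /=; apply: eq_big => [x|x _]; first by rewrite in_setT.
  by rewrite gs.
- by move=> [a1 l1] [a2 l2] /= [/val_inj -> /val_inj ->].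
move=> [l a] _ /= nz.
have [G cG] : exists G : graph g 'I_l 'I_a, connected_stable k G.
  apply: contrapT => none; case/eqP: nz; rewrite graph_sum_labelled big_pred0 ?mulr0 // => G.
  by apply/negP => cG; apply: none; exists G.
case/and5P: cG => inv c stG /eqP gE /eqP kE.
have := euler inv c stG; have [] := excess_bounds stG; rewrite !card_ord gE kE => lx ax e.
have lL : (l < (3 * N).+1)%N by lia.
have aL : (a < (3 * N).+1)%N by lia.
by exists (Ordinal aL, Ordinal lL).
Qed.

Lemma Cpoly_no_genus i k :
  (forall g, (2 < 2 * g + k)%N -> (2 * g + 2 * k)%N <> (i + 2)%N) ->
  (Cpoly N (vertex_poly N) leg_poly)`_i`_k = 0.
Proof.
move=> ng; rewrite /Cpoly !coef_sum big1 // => a _; rewrite !coef_sum big1 // => l _.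
by rewrite /conn_egf coefZ mul_polyC coefZ conn_sum_no_genus // mulr0.
Qed.

Lemma rep_chiMbar :
  represents N chiMbar_series (Cpoly N (vertex_poly N) leg_poly).
Proof.
have rg g n c : (2 < 2 * g + n)%N -> represents N (c \*o yz n%:Z (2 - 2 * g%:Z))
   (c%:P *: ('X^n *: 'X^(2 * g + 2 * n - 2))).
  move=> st; apply: rep_scale; have := rep_monomial N n (2 * g + 2 * n - 2); apply: rep_ext => m.
  by rewrite /yz; congr (monomial (_, _) m); lia.
split=> [|i k iN]; first apply: cone_sum => gn st.
  by have [] := rg _ _ (chiMbar gn.1 gn.2 / gn.2`!%:R) st.
have only g n : (2 < 2 * g + n)%N ->
    (chiMbar g n / n`!%:R \*o yz n%:Z (2 - 2 * g%:Z)) (pos k i) != 0 ->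
    n = k /\ (2 * g + 2 * k = i + 2)%N.
  move=> st /=; rewrite /yz /monomial; case: (pos k i =P _) => [E _|_].
    by case: E => kn iE; split; lia.
  by rewrite mulr0 eqxx.
have [[g [st gki]]|ng] := pselect (exists g, (2 < 2 * g + k)%N /\ (2 * g + 2 * k = i + 2)%N).
  rewrite -(chiMbar_box iN gki st) /chiMbar_series /series_sum.
  rewrite (@fsum_image _ unit (fun _ => (g, k))) => [|[] []//|[g' n'] st' nz].
    rewrite (big_pred1 tt) => [|[]]; last by rewrite mem_set.
    rewrite /= /yz /monomial (_ : pos k i == _) ?mulr1 //.
    by apply/eqP; congr (_, _); lia.
  by have [/= n'k g'E] := only _ _ st' nz; exists tt; congr (_, _); lia.
rewrite Cpoly_no_genus => [|g st gki]; last by apply: ng; exists g.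
apply: fsbig1 => -[g n] st; apply/eqP; apply: contrapT => /negP /(only _ _ st) [nk gki].
by apply: ng; exists g; rewrite -nk in gki *.
Qed.

End Assembly.

Theorem theorem6p3 :
  chiMbar_series \- Vtilde 0
    =1 series_log (Z1D_KP (fun n : nat => (n`!%:R)^-1 \*o Vtilde n)).
Proof.
pose Z := Z1D_KP (fun n : nat => (n`!%:R)^-1 \*o Vtilde n).
have lhs N := rep_sub (rep_chiMbar N) (rep_Vtilde0 N).
have rhs N : represents N (series_log Z) (log_trunc N (Zpoly N (vertex_poly_pos N) leg_poly)).
  apply: rep_log (rep_Z N).
  by apply: Zpoly0 => //; [exact: vertex_poly_pos_ord | exact: leg_poly_ord].
(* the degree in q of the exponent is taken as the order of truncation *)
move=> m; have [/in_coneP [k [i ->]]|out] := boolP (in_cone m); last first.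
  have [cl _] := lhs 0%N; have [cr _] := rhs 0%N.
  have -> : (chiMbar_series \- Vtilde 0) m = 0.
    by apply: contraNeq out => /cl.
  by apply/esym; apply: contraNeq out => /cr.
have [_ ->//] := lhs i; have [_ ->//] := rhs i.
rewrite (log_Zpoly (@vertex_poly_pos_ord i) (@leg_poly_ord)) //.
rewrite Cpoly_pos polyCN scaleNr opprD opprK.
by rewrite addrACA subrr addr0.
Qed.
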